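(* Let $k$ be a field. If $C$ is a coreflexive $k$-coalgebra, then there is an equivalence of algebraic $K$-theory spectra $$G^c(C)\simeq G^k(C^* ).$$
   Context: $C^*=\mathrm{Hom}_k(C,k)$ is a $k$-algebra with product $(f\star g)(c)=\sum_{(c)} f(c_{(1)})g(c_{(2)})$ and unit the counit of $C$. For a $k$-algebra $A$, the finite dual is the coalgebra $A^\circ=\{f\in A^*: \exists \text{ two-sided ideal } I\subseteq\ker f,\ \dim_k A/I<\infty\}$, with $\Delta f(a\otimes b)=f(ab)$ and $\varepsilon(f)=f(1_A)$. $C$ is coreflexive if the natural injective coalgebra homomorphism $\varepsilon_C\colon C\to (C^* )^\circ$, $\varepsilon_C(c)(f)=f(c)$, is an isomorphism. $G^c(C)$ is the algebraic $K$-theory spectrum of the abelian category of right $C$-comodules that are finite dimensional over $k$. $G^k(A)$ is the algebraic $K$-theory spectrum of the abelian category of right $A$-modules that are finite dimensional over $k$ (left modules give the same spectrum, via linear duality and $K(\mathcal A)\simeq K(\mathcal A^{\mathrm{op}})$). *)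

(* Defs.v *)
From HB Require Import structures.
From Stdlib Require Import Relation_Operators.
From mathcomp Require Import all_boot all_order all_algebra.
From mathcomp Require Import boolp classical_sets functions.

Set Implicit Arguments.
Unset Strict Implicit.
Unset Printing Implicit Defensive.

Import GRing.Theory.
Local Open Scope ring_scope.
Local Open Scope quotient_scope.

(* V (x) W consists of the formal sums of pairs, represented by sequences,
   modulo the following relation: two sums are identified when every bilinear
   map takes the same value on both. *)
Section Tensor.
Variables (k : fieldType) (V W : lmodType k).

Definition bsum (U : zmodType) (B : V -> W -> U) (s : seq (V * W)) : U :=
  \sum_(p <- s) B p.1 p.2.

Definition tensor_eq (s t : seq (V * W)) : bool :=
  `[< forall (U : lmodType k) (B : {bilinear V -> W -> U}),
        bsum B s = bsum B t >].

Lemma tensor_eq_equiv : equiv_class_of tensor_eq.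
Proof.
split=> [s | s t | t s u]; first exact/asboolP.
- by apply: asbool_equiv_eq; split=> e U B; rewrite e.
- by move=> /asboolP st /asboolP tu; apply/asboolP => U B; rewrite st tu.
Qed.

Canonical tensor_equiv := EquivRelPack tensor_eq_equiv.

Definition tensor := {eq_quot tensor_equiv}.
HB.instance Definition _ := Choice.on tensor.
HB.instance Definition _ := EqQuotient.on tensor.

Definition tens (v : V) (w : W) : tensor := \pi_tensor [:: (v, w)].

(* Sweedler notation: if t is the sum of the v_i (x) w_i, then tfold B t is the
   sum of the B v_i w_i; this is meaningful when B is bilinear. *)
Definition tfold (U : zmodType) (B : V -> W -> U) (t : tensor) : U :=
  bsum B (repr t).

Lemma tensorP (x y : tensor) :
  (forall (U : lmodType k) (B : {bilinear V -> W -> U}),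
     tfold B x = tfold B y) -> x = y.
Proof.
move=> e; rewrite -[x]reprK -[y]reprK; apply/eqquotP/asboolP => U B; exact: e.
Qed.

Lemma tfold_pi (U : lmodType k) (B : {bilinear V -> W -> U}) s :
  tfold B (\pi_tensor s) = bsum B s.
Proof.
have /eqquotP/asboolP : \pi_tensor (repr (\pi_tensor s)) = \pi_tensor s
  by rewrite reprK.
exact.
Qed.

Definition tzero : tensor := \pi_tensor [::].
Definition tadd (x y : tensor) : tensor := \pi_tensor (repr x ++ repr y).
Definition tscale (a : k) (x : tensor) : tensor :=
  \pi_tensor [seq (a *: p.1, p.2) | p <- repr x].
Definition topp (x : tensor) : tensor := tscale (-1) x.

Lemma tfold_zero (U : lmodType k) (B : {bilinear V -> W -> U}) :
  tfold B tzero = 0.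
Proof. by rewrite tfold_pi /bsum big_nil. Qed.

Lemma tfold_add (U : lmodType k) (B : {bilinear V -> W -> U}) x y :
  tfold B (tadd x y) = tfold B x + tfold B y.
Proof. by rewrite tfold_pi /bsum big_cat. Qed.

Lemma tfold_scale (U : lmodType k) (B : {bilinear V -> W -> U}) a x :
  tfold B (tscale a x) = a *: tfold B x.
Proof.
rewrite tfold_pi /tfold /bsum big_map scaler_sumr; apply: eq_bigr => p _ /=.
by rewrite linearZl_LR.
Qed.

Fact taddA : associative tadd.
Proof. by move=> x y z; apply: tensorP => U B; rewrite !tfold_add addrA. Qed.
Fact taddC : commutative tadd.
Proof. by move=> x y; apply: tensorP => U B; rewrite !tfold_add addrC. Qed.
Fact tadd0 : left_id tzero tadd.
Proof.
by move=> x; apply: tensorP => U B; rewrite tfold_add tfold_zero add0r.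
Qed.
Fact taddN : left_inverse tzero topp tadd.
Proof.
move=> x; apply: tensorP => U B.
by rewrite tfold_add tfold_scale tfold_zero scaleN1r addNr.
Qed.
HB.instance Definition _ :=
  GRing.isZmodule.Build tensor taddA taddC tadd0 taddN.

Fact tscaleA a b x : tscale a (tscale b x) = tscale (a * b) x.
Proof. by apply: tensorP => U B; rewrite !tfold_scale scalerA. Qed.
Fact tscale1 : left_id 1 tscale.
Proof. by move=> x; apply: tensorP => U B; rewrite tfold_scale scale1r. Qed.
Fact tscaleDr : right_distributive tscale +%R.
Proof.
move=> a x y; apply: tensorP => U B.
by rewrite [RHS]tfold_add !tfold_scale [in LHS]tfold_add scalerDr.
Qed.
Fact tscaleDl x : {morph tscale^~ x : a b / a + b}.
Proof.
move=> a b; apply: tensorP => U B.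
by rewrite [RHS]tfold_add !tfold_scale scalerDl.
Qed.
HB.instance Definition _ :=
  GRing.Zmodule_isLmodule.Build k tensor tscaleA tscale1 tscaleDr tscaleDl.

Fact tens_bilinear : bilinear_for *:%R *:%R tens.
Proof.
split=> [w a u v | v a u w]; apply: tensorP => U B;
  rewrite [RHS]tfold_add tfold_scale !tfold_pi /bsum !big_seq1 /=.
  by rewrite linearPl.
by rewrite linearPr.
Qed.
HB.instance Definition _ :=
  bilinear_isBilinear.Build k V W tensor *:%R *:%R tens tens_bilinear.

Lemma tfold_tens (U : lmodType k) (B : {bilinear V -> W -> U}) v w :
  tfold B (tens v w) = B v w.
Proof. by rewrite tfold_pi /bsum big_seq1. Qed.

Fact tfold_linear (U : lmodType k) (B : {bilinear V -> W -> U}) :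
  linear (tfold B).
Proof. by move=> a x y; rewrite tfold_add tfold_scale. Qed.
HB.instance Definition _ (U : lmodType k) (B : {bilinear V -> W -> U}) :=
  GRing.isLinear.Build k tensor U *:%R (tfold B) (tfold_linear B).

End Tensor.

Section TensorMaps.
Variable k : fieldType.

Definition tmap (V V' W W' : lmodType k) (f : V -> V') (g : W -> W')
    (t : tensor V W) : tensor V' W' :=
  tfold (fun v w => tens (f v) (g w)) t.

Definition tassoc (U V W : lmodType k) (t : tensor (tensor U V) W) :
    tensor U (tensor V W) :=
  tfold (fun x w => tfold (fun u v => tens u (tens v w)) x) t.

Lemma tfold_tmap (V V' W W' U : lmodType k) (f : V -> V') (g : W -> W')
    (B : {bilinear V' -> W' -> U}) (t : tensor V W) :
  tfold B (tmap f g t) = tfold (fun v w => B (f v) (g w)) t.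
Proof.
rewrite /tmap {2 3}/tfold /bsum raddf_sum; apply: eq_bigr => p _.
exact: tfold_tens.
Qed.

Definition bprecomp (V V' W W' U : lmodType k) (B : V' -> W' -> U)
  (f : V -> V') (g : W -> W') (v : V) (w : W) : U := B (f v) (g w).

Fact bprecomp_bilinear (V V' W W' U : lmodType k)
    (B : {bilinear V' -> W' -> U}) (f : {linear V -> V'})
    (g : {linear W -> W'}) :
  bilinear_for *:%R *:%R (bprecomp B f g).
Proof.
rewrite /bprecomp; split=> [w a u v | v a u w] /=; rewrite linearP.
  by rewrite linearPl.
by rewrite linearPr.
Qed.
HB.instance Definition _ (V V' W W' U : lmodType k)
    (B : {bilinear V' -> W' -> U}) (f : {linear V -> V'})
    (g : {linear W -> W'}) :=
  bilinear_isBilinear.Build k V W U *:%R *:%R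
    (bprecomp B f g) (bprecomp_bilinear B f g).

Lemma tmap_comp (V V' V'' W W' W'' : lmodType k)
    (f : {linear V -> V'}) (f' : {linear V' -> V''})
    (g : {linear W -> W'}) (g' : {linear W' -> W''}) (t : tensor V W) :
  tmap f' g' (tmap f g t) = tmap (f' \o f) (g' \o g) t.
Proof.
apply: tensorP => U B.
rewrite [RHS]tfold_tmap [LHS]tfold_tmap.
exact: (tfold_tmap f g (bprecomp B f' g')).
Qed.

End TensorMaps.

(* The library's algType excludes the zero algebra, which is the dual of the
   zero coalgebra. *)
HB.mixin Record isUnitalAlgebra (k : fieldType) A of GRing.Lmodule k A := {
  amul : {bilinear A -> A -> A};
  aone : A;
  amulA : associative amul;
  amul1l : left_id aone amul;
  amul1r : right_id aone amul
}.
#[short(type="unitalAlgType")]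
HB.structure Definition UnitalAlgebra (k : fieldType) :=
  { A of isUnitalAlgebra k A & GRing.Lmodule k A }.

HB.mixin Record isCoalgebra (k : fieldType) C of GRing.Lmodule k C := {
  comul : {linear C -> tensor C C};
  counit : {linear C -> k^o};
  comulA : forall c,
    tassoc (tmap comul id (comul c)) = tmap id comul (comul c);
  counitl : forall c, tfold (fun x y => counit x *: y) (comul c) = c;
  counitr : forall c, tfold (fun x y => counit y *: x) (comul c) = c
}.
#[short(type="coalgType")]
HB.structure Definition Coalgebra (k : fieldType) :=
  { C of isCoalgebra k C & GRing.Lmodule k C }.

Section Dual.
Variables (k : fieldType) (V : lmodType k).

Definition is_linear_form : pred (V -> k^o) := fun f => `[< linear f >].

Record dual := Dual { dual_fun :> V -> k^o; _ : is_linear_form dual_fun }.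

HB.instance Definition _ := [isSub for dual_fun].
HB.instance Definition _ := [Choice of dual by <:].

Fact is_linear_form_submod : submod_closed is_linear_form.
Proof.
split=> [|a f g /asboolP lf /asboolP lg]; apply/asboolP => b x y.
  by rewrite /= scaler0 addr0.
rewrite !fctE lf lg !scalerDr !scalerA ![b * a]mulrC.
by rewrite -!addrA; congr (_ + _); rewrite addrCA.
Qed.
HB.instance Definition _ :=
  GRing.isSubmodClosed.Build k (V -> k^o) is_linear_form is_linear_form_submod.
HB.instance Definition _ := [SubChoice_isSubLmodule of dual by <:].

Fact dual_linear (f : dual) : linear f.
Proof. by case: f => f /= /asboolP. Qed.
HB.instance Definition _ (f : dual) :=
  GRing.isLinear.Build k V k^o *:%R f (dual_linear f).

Lemma dualZ (f : dual) a x : f (a *: x) = a * f x.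
Proof. exact: linearZ_LR. Qed.

Lemma dualP (f g : dual) : f =1 g -> f = g.
Proof. by move=> fg; apply: val_inj; apply: funext. Qed.

Definition mkdual (f : {linear V -> k^o}) : dual :=
  @Dual f (introT (asboolP _) (linearP f)).

End Dual.

Section Scalars.
Variables (k : fieldType) (V W : lmodType k).

Definition mulf (f : V -> k^o) (g : W -> k^o) (v : V) (w : W) : k^o := f v * g w.

Fact mulf_bilinear (f : {linear V -> k^o}) (g : {linear W -> k^o}) :
  bilinear_for *:%R *:%R (mulf f g).
Proof.
rewrite /mulf; split=> [w a u v | v a u w] /=; rewrite linearP.
  by rewrite mulrDl -scalerAl.
by rewrite mulrDr -scalerAr.
Qed.
HB.instance Definition _ (f : {linear V -> k^o}) (g : {linear W -> k^o}) :=
  bilinear_isBilinear.Build k V W k^o *:%R *:%R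
    (mulf f g) (mulf_bilinear f g).

End Scalars.

Section DualAlgebra.
Variables (k : fieldType) (C : coalgType k).
Implicit Types f g h : dual C.

Definition conv f g : dual C := mkdual (tfold (mulf f g) \o comul).

Fact conv_bilinear : bilinear_for *:%R *:%R conv.
Proof.
split=> [g a f f' | f a g g']; apply: dualP => c.
  change (tfold (mulf (a *: f + f') g) (comul c) =
    a *: tfold (mulf f g) (comul c) + tfold (mulf f' g) (comul c)).
  rewrite /tfold /bsum scaler_sumr -big_split /=; apply: eq_bigr => p _.
  by rewrite /mulf scalerAl -mulrDl.
change (tfold (mulf f (a *: g + g')) (comul c) =
  a *: tfold (mulf f g) (comul c) + tfold (mulf f g') (comul c)).
rewrite /tfold /bsum scaler_sumr -big_split /=; apply: eq_bigr => p _.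
by rewrite /mulf scalerAr -mulrDr.
Qed.
HB.instance Definition _ :=
  bilinear_isBilinear.Build k (dual C) (dual C) (dual C) *:%R *:%R
    conv conv_bilinear.

Fact convA : associative conv.
Proof.
move=> f g h; apply: dualP => c /=.
rewrite -(tfold_tmap idfun comul (mulf f (tfold (mulf g h)))).
rewrite -comulA -[RHS](tfold_tmap comul idfun (mulf (tfold (mulf f g)) h)).
move: (tmap _ _ _) => t.
have -> : tassoc t = \sum_(p <- repr t) \sum_(q <- repr p.1)
    tens q.1 (tens q.2 p.2) by [].
rewrite raddf_sum; apply: eq_bigr => -[x w] _ /=.
rewrite raddf_sum [RHS]/mulf [in RHS]/tfold /bsum mulr_suml.
apply: eq_bigr => -[u v] _; rewrite [LHS]tfold_tens.
change (f u * tfold (mulf g h) (tens v w) = f u * g v * h w).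
by rewrite tfold_tens mulrA.
Qed.

Fact conv1l : left_id (mkdual counit) conv.
Proof.
move=> f; apply: dualP => c; rewrite -[in RHS](counitl c) /tfold /bsum raddf_sum.
by apply: eq_bigr => p _; apply: esym; apply: dualZ.
Qed.

Fact conv1r : right_id (mkdual counit) conv.
Proof.
move=> f; apply: dualP => c; rewrite -[in RHS](counitr c) /tfold /bsum raddf_sum.
by apply: eq_bigr => p _; rewrite [LHS]mulrC; apply: esym; apply: dualZ.
Qed.

HB.instance Definition _ :=
  isUnitalAlgebra.Build k (dual C) convA conv1l conv1r.
End DualAlgebra.

Section FiniteDual.
Variables (k : fieldType) (A : unitalAlgType k).
Local Open Scope classical_set_scope.

Definition two_sided_ideal (I : set A) : Prop :=
  [/\ I 0, forall a x y, I x -> I y -> I (a *: x + y)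
    & forall a x, I x -> I (amul a x) /\ I (amul x a)].

(* A/I has finite dimension: it embeds in some k^n. *)
Definition finite_codim (I : set A) : Prop :=
  exists (n : nat) (phi : {linear A -> 'rV[k]_n}), I = [set x | phi x = 0].

Definition in_finite_dual : pred (dual A) := fun f =>
  `[< exists I : set A,
        [/\ two_sided_ideal I, finite_codim I & I `<=` [set x | f x = 0]] >].

Section RowPair.
Variables (m n : nat) (phi : {linear A -> 'rV[k]_m}) (psi : {linear A -> 'rV[k]_n}).
Definition row_pair (x : A) : 'rV[k]_(m + n) := row_mx (phi x) (psi x).
Fact row_pair_linear : linear row_pair.
Proof. by move=> a x y; rewrite /row_pair scale_row_mx add_row_mx !linearP. Qed.
HB.instance Definition _ :=
  GRing.isLinear.Build k A 'rV[k]_(m + n) *:%R row_pair row_pair_linear.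
End RowPair.

Fact finite_codimI (I J : set A) :
  finite_codim I -> finite_codim J -> finite_codim (I `&` J).
Proof.
move=> [m [phi ->]] [n [psi ->]]; exists (m + n)%N, (row_pair phi psi).
apply/seteqP; split=> [x [/= p q]|x /= /eqP].
  by rewrite /row_pair p q row_mx0.
by rewrite row_mx_eq0 => /andP [/eqP p /eqP q].
Qed.

Fact in_finite_dual_submod : submod_closed in_finite_dual.
Proof.
split=> [|a f g /asboolP [I [iI cI sI]] /asboolP [J [iJ cJ sJ]]]; apply/asboolP.
  exists setT; split=> //; exists 0%N, (\0 : {linear A -> 'rV[k]_0}).
  by apply/seteqP; split.
exists (I `&` J); split; last 1 first.
- move=> x [/sI fx /sJ gx]; change (a *: f x + g x = 0).
  by rewrite fx gx scaler0 addr0.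
- case: iI iJ => I0 I1 I2 [J0 J1 J2]; split=> // [b x y [? ?] [? ?]|b x [Ix Jx]].
    by split; [apply: I1|apply: J1].
  by case: (I2 b x Ix) (J2 b x Jx) => ? ? [].
- exact: finite_codimI.
Qed.

Record finite_dual := FiniteDual {
  finite_dual_val :> dual A;
  finite_dualP : in_finite_dual finite_dual_val
}.
HB.instance Definition _ := [isSub for finite_dual_val].
HB.instance Definition _ := [Choice of finite_dual by <:].
HB.instance Definition _ :=
  GRing.isSubmodClosed.Build k (dual A) in_finite_dual in_finite_dual_submod.
HB.instance Definition _ := [SubChoice_isSubLmodule of finite_dual by <:].

(* t is the coproduct of f in A^o; it is determined by f, because A^o (x) A^o
   embeds in the dual of A (x) A. *)
Definition is_finite_dual_comul (f : finite_dual)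
    (t : tensor finite_dual finite_dual) : Prop :=
  forall a b, tfold (fun g h : finite_dual => g a * h b) t = f (amul a b).

End FiniteDual.

(* The evaluation map C -> (C^* )^o, c |-> (f |-> f c), is an isomorphism of
   coalgebras. *)
Definition coreflexive (k : fieldType) (C : coalgType k) : Prop :=
  exists e : {linear C -> finite_dual (dual C)},
    [/\ forall c f, e c f = f c, bijective e,
        forall c, is_finite_dual_comul (e c) (tmap e e (comul c))
      & forall c, e c aone = counit c].

(* Preadditive categories with a chosen zero object: the part of the structure of
   an abelian category in terms of which exactness and K-theory are defined. *)
Record addcat := AddCat {
  aobj :> Type;
  ahom : aobj -> aobj -> zmodType;
  aid : forall X, ahom X X;
  acomp : forall X Y Z, ahom Y Z -> ahom X Y -> ahom X Z;
  acompA : forall X Y Z T (h : ahom Z T) (g : ahom Y Z) (f : ahom X Y),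
    acomp h (acomp g f) = acomp (acomp h g) f;
  acomp1l : forall X Y (f : ahom X Y), acomp (aid Y) f = f;
  acomp1r : forall X Y (f : ahom X Y), acomp f (aid X) = f;
  acompDl : forall X Y Z (g g' : ahom Y Z) (f : ahom X Y),
    acomp (g + g') f = acomp g f + acomp g' f;
  acompDr : forall X Y Z (g : ahom Y Z) (f f' : ahom X Y),
    acomp g (f + f') = acomp g f + acomp g f';
  azero : aobj;
  azeroP : aid azero = 0
}.

(* Finite dimensional vector spaces with some extra structure; a morphism is a
   linear map that satisfies fdmor. *)
Record fdstruct (k : fieldType) := FdStruct {
  fdobj : Type;
  fdspace : fdobj -> vectType k;
  fdmor : forall X Y, 'Hom(fdspace X, fdspace Y) -> Prop;
  fdmor0 : forall X Y, @fdmor X Y 0;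
  fdmorB : forall X Y f g, @fdmor X Y f -> fdmor g -> fdmor (f - g);
  fdmor1 : forall X, @fdmor X X \1%VF;
  fdmorM : forall X Y Z f g, @fdmor X Y f -> @fdmor Y Z g -> fdmor (g \o f)%VF;
  fdzero : fdobj;
  fdzeroP : forall v : fdspace fdzero, v = 0
}.

Section FdCategory.
Variables (k : fieldType) (D : fdstruct k).

Section Hom.
Variables X Y : fdobj D.

Definition is_fdmor : pred 'Hom(fdspace X, fdspace Y) := fun f => `[< fdmor f >].

Record fdhom := FdHom {
  fdfun :> 'Hom(fdspace X, fdspace Y);
  fdhomP : is_fdmor fdfun
}.

HB.instance Definition _ := [isSub for fdfun].
HB.instance Definition _ := [Choice of fdhom by <:].
Fact is_fdmor_zmod : zmod_closed is_fdmor.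
Proof.
split=> [|f g /asboolP mf /asboolP mg]; apply/asboolP; first exact: fdmor0.
exact: fdmorB.
Qed.
HB.instance Definition _ :=
  GRing.isZmodClosed.Build 'Hom(fdspace X, fdspace Y) is_fdmor is_fdmor_zmod.
HB.instance Definition _ := [SubChoice_isSubZmodule of fdhom by <:].

End Hom.

Definition fdid X : fdhom X X := FdHom (introT (asboolP _) (fdmor1 X)).
Definition fdcomp X Y Z (g : fdhom Y Z) (f : fdhom X Y) : fdhom X Z :=
  FdHom (introT (asboolP _)
    (fdmorM (elimT (asboolP _) (fdhomP f)) (elimT (asboolP _) (fdhomP g)))).

Fact fdcompA X Y Z T (h : fdhom Z T) (g : fdhom Y Z) (f : fdhom X Y) :
  fdcomp h (fdcomp g f) = fdcomp (fdcomp h g) f.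
Proof. by apply: val_inj; rewrite /= comp_lfunA. Qed.
Fact fdcomp1l X Y (f : fdhom X Y) : fdcomp (fdid Y) f = f.
Proof. by apply: val_inj; rewrite /= comp_lfun1l. Qed.
Fact fdcomp1r X Y (f : fdhom X Y) : fdcomp f (fdid X) = f.
Proof. by apply: val_inj; rewrite /= comp_lfun1r. Qed.
Fact fdcompDl X Y Z (g g' : fdhom Y Z) (f : fdhom X Y) :
  fdcomp (g + g') f = fdcomp g f + fdcomp g' f.
Proof. by apply: val_inj; rewrite /= comp_lfunDl. Qed.
Fact fdcompDr X Y Z (g : fdhom Y Z) (f f' : fdhom X Y) :
  fdcomp g (f + f') = fdcomp g f + fdcomp g f'.
Proof. by apply: val_inj; rewrite /= comp_lfunDr. Qed.
Fact fdidz : fdid (fdzero D) = 0.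
Proof.
by apply: val_inj; apply/lfunP => v; rewrite [LHS]fdzeroP [RHS]fdzeroP.
Qed.

Definition fdcat : addcat :=
  AddCat fdcompA fdcomp1l fdcomp1r fdcompDl fdcompDr fdidz.

End FdCategory.

Section Comodules.
Variables (k : fieldType) (C : coalgType k).

Record fdcomod := FdComod {
  cospace : vectType k;
  coact : {linear cospace -> tensor cospace C};
  coactA : forall v,
    tassoc (tmap coact id (coact v)) = tmap id comul (coact v);
  coact1 : forall v,
    tfold (fun (x : cospace) (c : C) => counit c *: x) (coact v) = v
}.

Definition comod_mor (V W : fdcomod) (f : 'Hom(cospace V, cospace W)) : Prop :=
  forall v, coact W (f v) = tmap f id (coact V v).

Fact comod_mor0 V W : @comod_mor V W 0.
Proof.
move=> v; rewrite zero_lfunE linear0 /tmap /tfold /bsum big1 // => p _.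
by rewrite zero_lfunE linear0l.
Qed.
Fact comod_morB V W f g :
  @comod_mor V W f -> comod_mor g -> comod_mor (f - g).
Proof.
move=> mf mg v; rewrite add_lfunE opp_lfunE linearB mf mg /tmap /tfold /bsum.
rewrite -sumrB; apply: eq_bigr => p _.
by rewrite add_lfunE opp_lfunE linearBl.
Qed.
Fact comod_mor1 V : @comod_mor V V \1%VF.
Proof.
move=> v; rewrite id_lfunE; apply: tensorP => U B.
by rewrite tfold_tmap /tfold /bsum; apply: eq_bigr => p _; rewrite id_lfunE.
Qed.
Fact comod_morM V W X f g :
  @comod_mor V W f -> @comod_mor W X g -> comod_mor (g \o f)%VF.
Proof.
move=> mf mg v; rewrite comp_lfunE mg mf.
rewrite (tmap_comp f g idfun idfun); apply: eq_bigr => p _.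
by rewrite comp_lfunE.
Qed.

Fact row0P (v : 'rV[k]_0) : v = 0.
Proof. exact: thinmx0. Qed.

Fact comod0A (v : 'rV[k]_0) :
  tassoc (tmap (\0 : 'rV[k]_0 -> tensor 'rV[k]_0 C) id 0) = tmap id comul 0.
Proof.
apply: tensorP => U B; rewrite [RHS]tfold_tmap /tfold /bsum !big1 // => p _.
  by rewrite (row0P p.1) linear0l.
by rewrite (row0P p.1) linear0l.
Qed.
Fact comod01 (v : 'rV[k]_0) :
  tfold (fun (x : 'rV[k]_0) (c : C) => counit c *: x) 0 = v.
Proof. by rewrite [v]row0P; apply: row0P. Qed.
Definition comod0 : fdcomod :=
  @FdComod 'rV[k]_0 \0 comod0A comod01.

Definition fdcomod_struct : fdstruct k :=
  @FdStruct k fdcomod cospace comod_mor comod_mor0 comod_morB comod_mor1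
    comod_morM comod0 row0P.

Definition comod_cat : addcat := fdcat fdcomod_struct.

End Comodules.

Section Modules.
Variables (k : fieldType) (A : unitalAlgType k).

Record fdmod := FdMod {
  modspace : vectType k;
  mact : {bilinear modspace -> A -> modspace};
  mact1 : forall v, mact v aone = v;
  mactA : forall v a b, mact (mact v a) b = mact v (amul a b)
}.

Definition mod_mor (V W : fdmod) (f : 'Hom(modspace V, modspace W)) : Prop :=
  forall v a, f (mact V v a) = mact W (f v) a.

Fact mod_mor0 V W : @mod_mor V W 0.
Proof. by move=> v a; rewrite !zero_lfunE linear0l. Qed.
Fact mod_morB V W f g : @mod_mor V W f -> mod_mor g -> mod_mor (f - g).
Proof.
by move=> mf mg v a; rewrite !add_lfunE !opp_lfunE mf mg linearBl.
Qed.
Fact mod_mor1 V : @mod_mor V V \1%VF.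
Proof. by move=> v a; rewrite !id_lfunE. Qed.
Fact mod_morM V W X f g :
  @mod_mor V W f -> @mod_mor W X g -> mod_mor (g \o f)%VF.
Proof. by move=> mf mg v a; rewrite !comp_lfunE mf mg. Qed.

Definition zact (v : 'rV[k]_0) (a : A) : 'rV[k]_0 := 0.
Fact zact_bilinear : bilinear_for *:%R *:%R zact.
Proof. by split=> x a u v; exact: etrans (row0P _) (esym (row0P _)). Qed.
HB.instance Definition _ :=
  bilinear_isBilinear.Build k 'rV[k]_0 A 'rV[k]_0 *:%R *:%R zact zact_bilinear.

Definition mod0 : fdmod :=
  @FdMod 'rV[k]_0 zact (fun v => esym (row0P v)) (fun _ _ _ => erefl).

Definition fdmod_struct : fdstruct k :=
  @FdStruct k fdmod modspace mod_mor mod_mor0 mod_morB mod_mor1 mod_morM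
    mod0 (@row0P k).

Definition mod_cat : addcat := fdcat fdmod_struct.

End Modules.

Section Monotone.

Definition monotone p q (a : {ffun 'I_p.+1 -> 'I_q.+1}) : bool :=
  [forall i : 'I_p.+1, forall j : 'I_p.+1, (i <= j)%N ==> (a i <= a j)%N].

Lemma monotoneP p q (a : {ffun 'I_p.+1 -> 'I_q.+1}) :
  reflect (forall i j : 'I_p.+1, (i <= j)%N -> (a i <= a j)%N) (monotone a).
Proof.
apply: (iffP idP) => [/forallP h i j|h].
  by move/forallP: (h i) => /(_ j) /implyP.
by apply/forallP => i; apply/forallP => j; apply/implyP; apply: h.
Qed.

(* The morphisms [p] -> [q] of the simplex category. *)
Definition simp p q := {a : {ffun 'I_p.+1 -> 'I_q.+1} | monotone a}.

Lemma simpP p q (a : simp p q) (i j : 'I_p.+1) : (i <= j)%N -> (val a i <= val a j)%N.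
Proof. exact/monotoneP/valP. Qed.

Definition mksimp p q (a : 'I_p.+1 -> 'I_q.+1)
    (m : forall i j : 'I_p.+1, (i <= j)%N -> (a i <= a j)%N) : simp p q.
Proof.
by exists [ffun i => a i]; apply/monotoneP => i j; rewrite !ffunE; apply: m.
Defined.

Lemma mksimpE p q a m i : val (@mksimp p q a m) i = a i.
Proof. by rewrite ffunE. Qed.

Lemma simp_ext p q (a b : simp p q) : val a =1 val b -> a = b.
Proof. by move=> e; apply/val_inj/ffunP. Qed.

Definition simp_id p : simp p p := mksimp (fun (i j : 'I_p.+1) h => h).

Definition simp_comp p q r (b : simp q r) (a : simp p q) : simp p r :=
  mksimp (fun i j h => simpP b (simpP a h)).

Definition simp_const p (v : 'I_2) : simp p 1 :=
  mksimp (fun (i j : 'I_p.+1) _ => leqnn v).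

(* The p-simplices of Delta^1 that lie in its boundary. *)
Definition constant p (c : simp p 1) : bool := val c ord0 == val c ord_max.

Lemma simp_comp1l p q (a : simp p q) : simp_comp (simp_id q) a = a.
Proof. by apply: simp_ext => i; rewrite !mksimpE. Qed.
Lemma simp_comp1r p q (a : simp p q) : simp_comp a (simp_id p) = a.
Proof. by apply: simp_ext => i; rewrite !mksimpE. Qed.
Lemma simp_compA p q r s (c : simp r s) (b : simp q r) (a : simp p q) :
  simp_comp c (simp_comp b a) = simp_comp (simp_comp c b) a.
Proof. by apply: simp_ext => i; rewrite !mksimpE. Qed.

Lemma constantP p (c : simp p 1) i j : constant c -> val c i = val c j.
Proof.
move=> /eqP e; suff h l : val c l = val c ord0 by rewrite !h.
apply/val_inj/eqP; rewrite eqn_leq {1}e.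
by rewrite !simpP //; case: l => l /= /ltnSE.
Qed.

Lemma constant_comp p q (c : simp q 1) (a : simp p q) :
  constant c -> constant (simp_comp c a).
Proof. by move=> h; rewrite /constant !mksimpE; apply/eqP/constantP. Qed.

End Monotone.

Record sset := SSet {
  simplex :> nat -> Type;
  sact : forall p q, simp p q -> simplex q -> simplex p;
  sact1 : forall p (x : simplex p), sact (simp_id p) x = x;
  sactM : forall p q r (b : simp q r) (a : simp p q) (x : simplex r),
    sact (simp_comp b a) x = sact a (sact b x)
}.

Record smap (X Y : sset) := SMap {
  smap_fun :> forall p, X p -> Y p;
  smapP : forall p q (a : simp p q) (x : X q),
    smap_fun (sact a x) = sact a (smap_fun x)
}.

Definition scomp (X Y Z : sset) (g : smap Y Z) (f : smap X Y) : smap X Z.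
Proof. by exists (fun p x => g p (f p x)) => p q a x; rewrite !smapP. Defined.

(* f and g are the two ends of a map X x Delta^1 -> Y. *)
Definition shomotopy (X Y : sset) (f g : smap X Y) : Prop :=
  exists h : forall p, X p -> simp p 1 -> Y p,
    [/\ forall p q (a : simp p q) x c,
          h p (sact a x) (simp_comp c a) = sact a (h q x c),
        forall p x, h p x (simp_const p ord0) = f p x
      & forall p x, h p x (simp_const p ord_max) = g p x].

Definition shomotopic (X Y : sset) : smap X Y -> smap X Y -> Prop :=
  clos_refl_sym_trans (smap X Y) (@shomotopy X Y).

(* The horn Lambda^n_k consists of the simplices of Delta^n that miss some
   vertex other than k. *)
Definition in_horn n (k : 'I_n.+1) p (a : simp p n) : bool :=
  [exists i, (i != k) && [forall j, val a j != i]].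

(* Every map Lambda^n_k -> K with n > 0 extends to Delta^n. *)
Definition kan (K : sset) : Prop :=
  forall n (k : 'I_n.+2) (h : forall p, simp p n.+1 -> K p),
    (forall p q (b : simp p q) (a : simp q n.+1), in_horn k a ->
       h p (simp_comp a b) = sact b (h q a)) ->
    exists x : K n.+1, forall p (a : simp p n.+1), in_horn k a ->
      h p a = sact a x.

(* Weak homotopy equivalences, characterized by the sets [-, K] of homotopy
   classes of maps to Kan complexes K. *)
Definition weak_equivalence (X Y : sset) (f : smap X Y) : Prop :=
  forall K : sset, kan K ->
    (forall w : smap X K, exists u : smap Y K, shomotopic (scomp u f) w) /\
    (forall u v : smap Y K, shomotopic (scomp u f) (scomp v f) ->
       shomotopic u v).

Record psset := PSSet {
  psset_sset :> sset;
  spoint : forall p, psset_sset p;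
  spointP : forall p q (a : simp p q), sact a (spoint q) = spoint p
}.

(* The loop space of Z: its p-simplices are the maps Delta^1 x Delta^p -> Z that
   send the boundary of Delta^1 to the base point. *)
Section Loop.
Variable Z : psset.

Record loop_simplex p := LoopSimplex {
  loop_fun :> forall r, simp r 1 -> simp r p -> Z r;
  loop_nat : forall r s (b : simp r s) c a,
    loop_fun (simp_comp c b) (simp_comp a b) = sact b (loop_fun c a);
  loop_pt : forall r (c : simp r 1) a, constant c -> loop_fun c a = spoint Z r
}.

Lemma loop_ext p (x y : loop_simplex p) :
  (forall r c a, @loop_fun p x r c a = y r c a) -> x = y.
Proof.
case: x y => [x xn xp] [y yn yp] /= e.
have {}e : x = y.
  apply: functional_extensionality_dep => r.
  by apply: funext => c; apply: funext => a.
by case: _ / e yn yp => yn yp; congr LoopSimplex; apply: Prop_irrelevance.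
Qed.

Definition loop_act p q (a : simp p q) (x : loop_simplex q) : loop_simplex p.
Proof.
exists (fun r c b => x r c (simp_comp a b)) => [r s b c d|r c b hc].
  by rewrite simp_compA loop_nat.
exact: loop_pt.
Defined.

Definition loop : sset.
Proof.
exists loop_simplex loop_act => [p x|p q r b a x]; apply: loop_ext => s c d /=.
  by rewrite simp_comp1l.
by rewrite simp_compA.
Defined.

End Loop.

(* Sequential spectra of simplicial sets: S^1 is Delta^1 modulo its boundary,
   and bond is the structure map S^1 /\ E_n -> E_(n+1). *)
Record spectrum := Spectrum {
  level :> nat -> psset;
  bond : forall n p, simp p 1 -> level n p -> level n.+1 p;
  bondP : forall n p q (a : simp p q) (c : simp q 1) (x : level n q),
    bond (simp_comp c a) (sact a x) = sact a (bond c x);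
  bond_constant : forall n p (c : simp p 1) (x : level n p), constant c ->
    bond c x = spoint (level n.+1) p;
  bond_point : forall n p (c : simp p 1),
    bond c (spoint (level n) p) = spoint (level n.+1) p
}.

Record spmap (E F : spectrum) := SpMap {
  spmap_map :> forall n, smap (E n) (F n);
  spmap_point : forall n p, spmap_map n p (spoint (E n) p) = spoint (F n) p;
  spmap_bond : forall n p (c : simp p 1) (x : E n p),
    spmap_map n.+1 p (bond c x) = bond c (spmap_map n p x)
}.

Definition spcomp (E F G : spectrum) (g : spmap F G) (f : spmap E F) :
  spmap E G.
Proof.
exists (fun n => scomp (g n) (f n)) => [n p|n p c x] /=.
  by rewrite !spmap_point.
by rewrite !spmap_bond.
Defined.

(* f and g are the two ends of a map of spectra E /\ (Delta^1)_+ -> F. *)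
Definition sphomotopy (E F : spectrum) (f g : spmap E F) : Prop :=
  exists h : forall n p, E n p -> simp p 1 -> F n p,
    [/\ forall n p q (a : simp p q) x c,
          h n p (sact a x) (simp_comp c a) = sact a (h n q x c),
        forall n p c, h n p (spoint (E n) p) c = spoint (F n) p,
        forall n p (c : simp p 1) x d,
          h n.+1 p (bond c x) d = bond c (h n p x d),
        forall n p x, h n p x (simp_const p ord0) = f n p x
      & forall n p x, h n p x (simp_const p ord_max) = g n p x].

Definition sphomotopic (E F : spectrum) : spmap E F -> spmap E F -> Prop :=
  clos_refl_sym_trans (spmap E F) (@sphomotopy E F).

(* The adjoint Z_n -> loop Z_(n+1) of the structure map. *)
Definition adjoint_bond (Z : spectrum) n : smap (Z n) (loop (Z n.+1)).
Proof.
have nat p (x : Z n p) r s (b : simp r s) (c : simp s 1) (a : simp s p) :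
    bond (simp_comp c b) (sact (simp_comp a b) x) = sact b (bond c (sact a x)).
  by rewrite sactM bondP.
have pt p (x : Z n p) r (c : simp r 1) (a : simp r p) : constant c ->
    bond c (sact a x) = spoint (Z n.+1) r.
  exact: bond_constant.
exists (fun p x => LoopSimplex (nat p x) (pt p x) : loop (Z n.+1) p).
by move=> p q a x; apply: loop_ext => r c d /=; rewrite sactM.
Defined.

Definition omega_spectrum (Z : spectrum) : Prop :=
  forall n, kan (Z n) /\ weak_equivalence (adjoint_bond Z n).

Definition level_equivalence (E F : spectrum) (f : spmap E F) : Prop :=
  forall n, weak_equivalence (f n).

Definition level_injective (E F : spectrum) (f : spmap E F) : Prop :=
  forall n p, injective (f n p).

Definition injective_spectrum (Z : spectrum) : Prop :=
  forall (E F : spectrum) (i : spmap E F),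
    level_injective i -> level_equivalence i ->
    forall g : spmap E Z, exists h : spmap F Z,
      forall n p (x : E n p), h n p (i n p x) = g n p x.

(* As in Hovey-Shipley-Smith, "Symmetric spectra", Definition 3.1.3: f induces
   bijections on cohomology with coefficients in every injective
   Omega-spectrum. For sequential spectra these are the maps that induce
   isomorphisms of stable homotopy groups. *)
Definition stable_equivalence (E F : spectrum) (f : spmap E F) : Prop :=
  forall Z : spectrum, injective_spectrum Z -> omega_spectrum Z ->
    (forall w : spmap E Z, exists u : spmap F Z, sphomotopic (spcomp u f) w) /\
    (forall u v : spmap F Z, sphomotopic (spcomp u f) (spcomp v f) ->
       sphomotopic u v).

(* E and F are isomorphic in the stable homotopy category: they are connected
   by a zigzag of stable equivalences. *)
Definition spectra_equivalent : spectrum -> spectrum -> Prop :=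
  clos_refl_sym_trans spectrum
    (fun E F => exists f : spmap E F, stable_equivalence f).

Section ShortExact.
Variables (A : addcat) (X Y Z : A).

Definition is_kernel (g : ahom Y Z) (f : ahom X Y) : Prop :=
  acomp g f = 0 /\
  forall (W : A) (h : ahom W Y), acomp g h = 0 ->
    exists! u : ahom W X, acomp f u = h.

Definition is_cokernel (f : ahom X Y) (g : ahom Y Z) : Prop :=
  acomp g f = 0 /\
  forall (W : A) (h : ahom Y W), acomp h f = 0 ->
    exists! u : ahom Z W, acomp u g = h.

Definition short_exact (f : ahom X Y) (g : ahom Y Z) : Prop :=
  is_kernel g f /\ is_cokernel f g.

End ShortExact.

(* A sum diagram combines two constructions for an abelian category A.

   - Waldhausen's S-construction: for a finite linear order J, S_J(A) is the set
     of functors (i <= j) |-> X(i, j) such that X(i, i) = 0 and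
     0 -> X(i, j) -> X(i, l) -> X(j, l) -> 0 is exact for i <= j <= l.

   - Segal's delooping by direct sums: for a finite pointed set T/B (T with the
     subset B collapsed to the base point), A(T/B) is the category of families
     of objects indexed by T \ B, together with a choice of all their partial
     direct sums. Such a choice consists of an object X(S) for every subset S of
     T \ B, and of maps X(S) -> X(S') for all R contained in S and S', namely
     "project to X(R), then include X(R) in X(S')". These maps are functorial and
     additive in R, and this expresses that X(S) is the biproduct of the X({t})
     for t in S: the maps with R = {t} between X(S) and X({t}) are the
     projections and injections. Hence A(T/B) is equivalent to A^(T \ B), and
     a map T/B -> T'/B' acts by X'(S') = X(preimage of S').

   The elements of S_J(A(T/B)) thus are indexed by a subset of T \ B and an
   arrow i <= j of J. *)
Section SumDiagrams.
Variables (A : addcat) (J : Type) (le : rel J) (T : finType) (B : {set T}).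

Record sumidx := SumIdx {
  iset : {set T};
  isrc : J;
  itgt : J;
  isetP : [disjoint iset & B];
  ileP : le isrc itgt
}.

Definition sumhom (x y : sumidx) (R : {set T}) : bool :=
  [&& R \subset iset x, R \subset iset y,
      le (isrc x) (isrc y) & le (itgt x) (itgt y)].

Record sumdiag := SumDiag {
  dobj : sumidx -> A;
  dmap : forall x y R, sumhom x y R -> ahom (dobj x) (dobj y);
  dmap_id : forall x (h : sumhom x x (iset x)), dmap h = aid (dobj x);
  dmap_comp : forall x y z R R' (h : sumhom x y R) (h' : sumhom y z R')
    (h'' : sumhom x z (R :&: R')), dmap h'' = acomp (dmap h') (dmap h);
  dmap_add : forall x y R R' (h : sumhom x y R) (h' : sumhom x y R')
    (h'' : sumhom x y (R :|: R')), [disjoint R & R'] ->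
    dmap h'' = dmap h + dmap h';
  dobj_set0 : forall x, iset x = finset.set0 -> dobj x = azero A;
  dobj_diag : forall x, isrc x = itgt x -> dobj x = azero A;
  dmap_exact : forall x y z (h : sumhom x y (iset x)) (h' : sumhom y z (iset y)),
    iset x = iset y -> iset y = iset z ->
    isrc x = isrc y -> itgt y = itgt z -> itgt x = isrc z ->
    short_exact (dmap h) (dmap h')
}.

Lemma azero_hom (X : A) (f g : ahom (azero A) X) : f = g.
Proof.
have h0 (u : ahom (azero A) X) : u = 0.
  have e : acomp u (0 : ahom (azero A) (azero A)) = 0.
    by apply: (addrI (acomp u 0)); rewrite -acompDr !addr0.
  by rewrite -[u]acomp1r azeroP.
by rewrite [f]h0 [g]h0.
Qed.

Lemma short_exact0 (f g : ahom (azero A) (azero A)) : short_exact f g.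
Proof.
have z (W : A) (h : ahom W (azero A)) : h = 0.
  have e : acomp (0 : ahom (azero A) (azero A)) h = 0.
    by apply: (addrI (acomp 0 h)); rewrite -acompDl !addr0.
  by rewrite -[h]acomp1l azeroP.
split; split; try exact: azero_hom.
  by move=> W h _; exists 0; split=> [|u _]; rewrite ?[u]z //; rewrite [LHS]z [RHS]z.
move=> W h _; exists 0; split=> [|u _]; exact: azero_hom.
Qed.

Definition sumdiag0 : sumdiag.
Proof.
by exists (fun=> azero A) (fun x y R h => 0) => *;
  (exact: azero_hom || exact: short_exact0 || by []).
Defined.

Lemma sumdiag_eq0 (X : sumdiag) :
  (forall x, dobj X x = azero A) -> X = sumdiag0.
Proof.
case: X => o m m1 mM mD o0 od me /= e.
have {}e : o = (fun=> azero A) by apply: funext.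
subst o.
have em : m = (fun x y R h => 0).
  apply: functional_extensionality_dep => x.
  apply: functional_extensionality_dep => y.
  apply: functional_extensionality_dep => R.
  by apply: funext => h; apply: azero_hom.
subst m; congr SumDiag; exact: Prop_irrelevance.
Qed.

Lemma sumidx_eq (x y : sumidx) :
  iset x = iset y -> isrc x = isrc y -> itgt x = itgt y -> x = y.
Proof.
case: x y => [s i j p q] [s' i' j' p' q'] /= es ei ej; subst s' i' j'.
by congr SumIdx; apply: bool_irrelevance.
Qed.

Definition sumcore (X : sumdiag) :
    {o : sumidx -> A & forall x y R, sumhom x y R -> ahom (o x) (o y)} :=
  existT _ (dobj X) (@dmap X).

Lemma sumcore_inj (X Y : sumdiag) : sumcore X = sumcore Y -> X = Y.
Proof.
case: X Y => [o m m1 mM mD o0 od me] [o' m' m1' mM' mD' o0' od' me'].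
rewrite /sumcore /= => e.
pose D (c : {o : sumidx -> A &
    forall x y R, sumhom x y R -> ahom (o x) (o y)}) := @SumDiag (projT1 c) (projT2 c).
have eD : forall c c', c = c' -> forall p1 p2 p3 p4 p5 p6 q1 q2 q3 q4 q5 q6,
    D c p1 p2 p3 p4 p5 p6 = D c' q1 q2 q3 q4 q5 q6.
  by move=> c _ <- *; congr SumDiag; apply: Prop_irrelevance.
exact: (eD _ _ e).
Qed.

End SumDiagrams.

Section Reindex.
Variables (A : addcat).

Record reidx (J J' : Type) (le : rel J) (le' : rel J') (T T' : finType)
    (B : {set T}) (B' : {set T'}) := ReIdx {
  rset : T -> T';
  rord : J' -> J;
  rsetP : forall t, t \in B -> rset t \in B';
  rordP : forall i j, le' i j -> le (rord i) (rord j)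
}.

Section Act.
Variables (J J' : Type) (le : rel J) (le' : rel J') (T T' : finType).
Variables (B : {set T}) (B' : {set T'}) (r : reidx le le' B B').

Fact ridx_set (S : {set T'}) :
  [disjoint S & B'] -> [disjoint rset r @^-1: S & B].
Proof.
move=> d; apply/pred0P => t /=; apply/negP => /andP [].
by rewrite inE => tS /(rsetP r) tB; move/pred0P: d => /(_ (rset r t)) /=;
  rewrite tS tB.
Qed.

Definition ridx (x : sumidx le' B') : sumidx le B :=
  SumIdx (ridx_set (isetP x)) (rordP r (ileP x)).

Fact ridx_hom (x y : sumidx le' B') R :
  sumhom x y R -> sumhom (ridx x) (ridx y) (rset r @^-1: R).
Proof.
case/and4P => Rx Ry s t; apply/and4P; split; rewrite /= ?preimsetS //;
  exact: rordP.
Qed.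

Fact preim_disjoint (R R' : {set T'}) :
  [disjoint R & R'] -> [disjoint rset r @^-1: R & rset r @^-1: R'].
Proof.
by rewrite -!finset.setI_eq0 -preimsetI => /eqP ->; rewrite preimset0.
Qed.

Definition reindex (X : sumdiag A le B) : sumdiag A le' B'.
Proof.
exists (fun x => dobj X (ridx x)) (fun x y R h => dmap X (ridx_hom h)).
- by move=> x h; apply: dmap_id.
- move=> x y z R R' h h' h''; move: (ridx_hom h''); rewrite preimsetI => k.
  exact: dmap_comp.
- move=> x y R R' h h' h'' d; move: (ridx_hom h''); rewrite preimsetU => k.
  exact/dmap_add/preim_disjoint.
- by move=> x e; apply: dobj_set0; rewrite /= e preimset0.
- by move=> x e; apply: dobj_diag; rewrite /= e.
- move=> x y z h h' e1 e2 e3 e4 e5.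
  by apply: dmap_exact; rewrite /= ?e1 ?e2 ?e3 ?e4 ?e5.
Defined.

Lemma reindex0 : reindex (sumdiag0 A le B) = sumdiag0 A le' B'.
Proof. exact: sumdiag_eq0. Qed.

End Act.

Definition reidx_id J (le : rel J) (T : finType) (B : {set T}) :
    reidx le le B B :=
  @ReIdx _ _ le le _ _ B B id id (fun _ h => h) (fun _ _ h => h).

Definition reidx_comp J J' J'' (le : rel J) (le' : rel J') (le'' : rel J'')
    (T T' T'' : finType) (B : {set T}) (B' : {set T'}) (B'' : {set T''})
    (r' : reidx le' le'' B' B'') (r : reidx le le' B B') : reidx le le'' B B'' :=
  @ReIdx _ _ le le'' _ _ B B'' (rset r' \o rset r) (rord r \o rord r')
    (fun t h => rsetP r' (rsetP r h)) (fun i j h => rordP r (rordP r' h)).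

Section Ext.
Variables (J J' : Type) (le : rel J) (le' : rel J') (T T' : finType).
Variables (B : {set T}) (B' : {set T'}) (X : sumdiag A le B).
Implicit Type f : sumidx le' B' -> sumidx le B.
Implicit Type g : {set T'} -> {set T}.

Definition pullcore f g
    (H : forall x y R, sumhom x y R -> sumhom (f x) (f y) (g R)) :
    {o : sumidx le' B' -> A & forall x y R, sumhom x y R -> ahom (o x) (o y)} :=
  existT _ (fun x => dobj X (f x)) (fun x y R h => dmap X (H x y R h)).

Lemma pullcore_ext f f' g g' H H' :
  f =1 f' -> g =1 g' -> @pullcore f g H = @pullcore f' g' H'.
Proof.
move=> /funext ef /funext eg; subst f' g'.
by congr pullcore; apply: Prop_irrelevance.
Qed.

End Ext.

Lemma reindex_ext J J' (le : rel J) (le' : rel J') (T T' : finType)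
    (B : {set T}) (B' : {set T'}) (r r' : reidx le le' B B') X :
  rset r =1 rset r' -> rord r =1 rord r' -> reindex r X = reindex r' X.
Proof.
move=> es eo; apply: sumcore_inj.
have eS S : rset r @^-1: S = rset r' @^-1: S.
  by apply/finset.setP => t; rewrite !inE es.
apply: (pullcore_ext X (@ridx_hom _ _ _ _ _ _ _ _ (r)) (@ridx_hom _ _ _ _ _ _ _ _ (r'))) => [x|S] //.
by apply: sumidx_eq; rewrite /= ?eS ?eo.
Qed.

Lemma reindex_id J (le : rel J) (T : finType) (B : {set T}) X :
  reindex (reidx_id le B) X = X.
Proof.
apply: sumcore_inj.
have e (S : {set T}) : id @^-1: S = S by apply/finset.setP => t; rewrite !inE.
apply: (pullcore_ext X (@ridx_hom _ _ _ _ _ _ _ _ (reidx_id le B)) (fun _ _ _ h => h)) => //.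
by move=> x; apply: sumidx_eq; rewrite /= ?e.
Qed.

Lemma reindex_comp J J' J'' (le : rel J) (le' : rel J') (le'' : rel J'')
    (T T' T'' : finType) (B : {set T}) (B' : {set T'}) (B'' : {set T''})
    (r' : reidx le' le'' B' B'') (r : reidx le le' B B') X :
  reindex (reidx_comp r' r) X = reindex r' (reindex r X).
Proof.
apply: sumcore_inj.
have e (S : {set T''}) :
    (rset r' \o rset r) @^-1: S = rset r @^-1: (rset r' @^-1: S).
  by apply/finset.setP => t; rewrite !inE.
apply: (pullcore_ext X (@ridx_hom _ _ _ _ _ _ _ _ (reidx_comp r' r))
  (fun x y R h => ridx_hom r (ridx_hom r' h))) => // x.
by apply: sumidx_eq; rewrite /= ?e.
Qed.

End Reindex.

Section KTheory.
Variable A : addcat.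

(* K(A)_(n+1) has as p-simplices S_J(A(S^n_p)) for J = [p]^op * [p]. So it is the
   edgewise subdivision, in the direction of S, of Segal's n-fold delooping of the
   simplicial set s.A (the objects of Waldhausen's S.A, which already has the
   homotopy type of the nerve of the isomorphisms of S.A). Edgewise subdivision
   does not change the geometric realization up to homeomorphism, and turns S.A
   into Quillen's Q-construction (Waldhausen, "Algebraic K-theory of spaces",
   1.9), so that K(A)_1 is equivalent to BQA and its loop space to K(A).
   K(A)_0 is a point; from level 1 on, this is an Omega-spectrum up to fibrant
   replacement of the levels. *)

(* The linear order [p]^op * [p], isomorphic to [2p+1]. *)
Definition doubled p := ('I_p.+1 + 'I_p.+1)%type.
Definition doubled_le p (x y : doubled p) : bool :=
  match x, y with
  | inl i, inl j => (j <= i)%N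
  | inl _, inr _ => true
  | inr _, inl _ => false
  | inr i, inr j => (i <= j)%N
  end.
Definition doubled_act p q (a : simp p q) (x : doubled p) : doubled q :=
  match x with inl i => inl (val a i) | inr i => inr (val a i) end.

Fact doubled_actP p q (a : simp p q) x y :
  doubled_le x y -> doubled_le (doubled_act a x) (doubled_act a y).
Proof. by case: x y => i [] j //=; apply: simpP. Qed.

(* The sphere S^n = (S^1)^(/\ n) is the cube (Delta^1)^n modulo its boundary. *)
Definition cube n p : finType := {ffun 'I_n -> simp p 1}.
Definition cube_boundary n p : {set cube n p} :=
  [set t : cube n p | [exists i, constant (t i)]].
Definition cube_act n p q (a : simp p q) (t : cube n q) : cube n p :=
  [ffun i => simp_comp (t i) a].
Definition cube_cons n p (c : simp p 1) (t : cube n p) : cube n.+1 p :=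
  [ffun i => if unlift ord0 i is Some j then t j else c].

Fact cube_actP n p q (a : simp p q) t :
  t \in cube_boundary n q -> cube_act a t \in cube_boundary n p.
Proof.
rewrite !inE => /existsP [i ti]; apply/existsP; exists i.
by rewrite ffunE; apply: constant_comp.
Qed.

Fact cube_consP n p (c : simp p 1) t :
  t \in cube_boundary n p -> cube_cons c t \in cube_boundary n.+1 p.
Proof.
rewrite !inE => /existsP [i ti]; apply/existsP; exists (lift ord0 i).
by rewrite ffunE liftK.
Qed.

Fact cube_cons_constant n p (c : simp p 1) t :
  constant c -> cube_cons c t \in cube_boundary n.+1 p.
Proof.
by move=> cc; rewrite inE; apply/existsP; exists ord0; rewrite ffunE unlift_none.
Qed.

Definition act_idx n p q (a : simp p q) :
    reidx (@doubled_le q) (@doubled_le p) (cube_boundary n q)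
      (cube_boundary n p) :=
  ReIdx (@cube_actP n p q a) (@doubled_actP p q a).

Definition cons_idx n p (c : simp p 1) :
    reidx (@doubled_le p) (@doubled_le p) (cube_boundary n p)
      (cube_boundary n.+1 p) :=
  @ReIdx _ _ (@doubled_le p) (@doubled_le p) _ _ _ _
    (cube_cons c) id (@cube_consP n p c) (fun _ _ h => h).

Definition kdiag n p := sumdiag A (@doubled_le p) (cube_boundary n p).

Definition kspace_sset (n : nat) : sset.
Proof.
exists (kdiag n) (fun p q a => reindex (act_idx n a)) => [p X|p q r b a X].
  rewrite -[RHS]reindex_id; apply: reindex_ext => [t|[] i] /=.
  - by apply/ffunP => i; rewrite ffunE simp_comp1r.
  - by rewrite ffunE.
  - by rewrite ffunE.
rewrite -reindex_comp; apply: reindex_ext => [t|[] i] /=.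
- by apply/ffunP => i; rewrite !ffunE simp_compA.
- by rewrite ffunE.
- by rewrite ffunE.
Defined.

Definition kspace (n : nat) : psset.
Proof.
exists (kspace_sset n) (fun p => sumdiag0 A _ _) => p q a; exact: reindex0.
Defined.

Definition point : psset.
Proof.
pose X : sset := @SSet (fun=> unit) (fun _ _ _ => id) (fun _ _ => erefl)
  (fun _ _ _ _ _ _ => erefl).
by exists X (fun=> tt).
Defined.

Definition klevel n : psset := if n is m.+1 then kspace m else point.

Definition kbond n : forall p, simp p 1 -> klevel n p -> klevel n.+1 p :=
  match n with
  | 0 => fun p _ _ => spoint (kspace 0) p
  | m.+1 => fun p c => reindex (cons_idx m c)
  end.

Definition ktheory : spectrum.
Proof.
exists klevel kbond => [[|n] p q a c x|[|n] p c x cc|[|n] p c] //=.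
- by rewrite reindex0.
- rewrite -!reindex_comp; apply: reindex_ext => [t|i] //=.
  apply/ffunP => i; rewrite !ffunE; case: unlift => [j|//].
  by rewrite ffunE.
- apply: sumdiag_eq0 => y /=; apply: dobj_set0 => /=.
  apply/finset.setP => t; rewrite !inE; apply/negP => yt.
  have /pred0P/(_ (cube_cons c t)) := isetP y.
  by rewrite /= yt cube_cons_constant.
- exact: reindex0.
Defined.

End KTheory.

Definition Gc (k : fieldType) (C : coalgType k) : spectrum :=
  ktheory (comod_cat C).
Definition Gk (k : fieldType) (A : unitalAlgType k) : spectrum :=
  ktheory (mod_cat A).

(* Main.v *)
(* A right C-comodule is a left C^*-module, by f . v = sum of the f(v_1) v_0, and
   transposing the action makes it a right C^*-module. This defines a
   contravariant functor from finite dimensional comodules to finite dimensional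
   modules. It is fully faithful because C^* separates the points of C (as C embeds
   in the finite dual of C^* ), hence also those of V (x) C and V (x) C (x) C. It is
   essentially surjective because the matrix coefficients of a finite dimensional
   module vanish on its annihilator, an ideal of finite codimension; so they are in
   the finite dual, that is in C, and are the coefficients of a comodule structure.

   An equivalence of categories induces a homotopy equivalence of K-theory spectra:
   a natural isomorphism F -> G gives the homotopy that sends a diagram X and a
   simplex c of Delta^1 to the diagram with F(X) where c is 0 and G(X) where c is 1.
   Reversing the linear orders [p]^op * [p] identifies the K-theory of a category
   with that of its opposite. *)
From HB Require Import structures.
From Stdlib Require Import Relation_Operators.
From mathcomp Require Import all_boot all_algebra.
From mathcomp Require Import boolp classical_sets.
Require Import Defs.

Set Implicit Arguments.
Unset Strict Implicit.
Unset Printing Implicit Defensive.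

Import GRing.Theory.
Local Open Scope ring_scope.

(** * Homotopy equivalences of spectra *)

Section HomotopyEquivalence.

Definition spid (E : spectrum) : spmap E E.
Proof. by exists (fun n => @SMap (E n) (E n) (fun p => id) (fun _ _ _ _ => erefl)). Defined.

(** The constant homotopy works; this spares comparing the proof fields of the two maps. *)
Lemma sphomotopy_ext (E F : spectrum) (f g : spmap E F) :
  (forall n p x, f n p x = g n p x) -> sphomotopy f g.
Proof.
move=> fg; exists (fun n p x _ => f n p x); split=> //.
- by move=> n p q a x c; rewrite smapP.
- by move=> n p c; rewrite spmap_point.
- by move=> n p c x d; rewrite spmap_bond.
Qed.

Lemma sphomotopic_compl (E F G : spectrum) (f f' : spmap E F) (u : spmap F G) :
  sphomotopic f f' -> sphomotopic (spcomp u f) (spcomp u f').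
Proof.
elim=> {f f'} [f f' [h [hn hp hb h0 h1]]|f|f f' _|f g h _ fg _ gh].
- apply: rst_step; exists (fun n p x c => u n p (h n p x c)).
  split=> [n p q a x c|n p c|n p c x d|n p x|n p x] /=.
  + by rewrite hn smapP.
  + by rewrite hp spmap_point.
  + by rewrite hb spmap_bond.
  + by rewrite h0.
  + by rewrite h1.
- exact: rst_refl.
- exact: rst_sym.
- exact: rst_trans fg gh.
Qed.

Lemma sphomotopic_compr (E F G : spectrum) (f : spmap E F) (u u' : spmap F G) :
  sphomotopic u u' -> sphomotopic (spcomp u f) (spcomp u' f).
Proof.
elim=> {u u'} [u u' [h [hn hp hb h0 h1]]|u|u u' _|u v w _ uv _ vw].
- apply: rst_step; exists (fun n p x c => h n p (f n p x) c).
  split=> [n p q a x c|n p c|n p c x d|n p x|n p x] /=.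
  + by rewrite smapP hn.
  + by rewrite spmap_point hp.
  + by rewrite spmap_bond hb.
  + by rewrite h0.
  + by rewrite h1.
- exact: rst_refl.
- exact: rst_sym.
- exact: rst_trans uv vw.
Qed.

(** Composition with [g] is inverse to composition with [f] on homotopy classes of maps into [Z]. *)
Lemma homotopy_inverse_stable (E F : spectrum) (f : spmap E F) (g : spmap F E) :
  sphomotopic (spcomp g f) (spid E) -> sphomotopic (spcomp f g) (spid F) ->
  stable_equivalence f.
Proof.
move=> gf fg Z _ _.
have cancel (u : spmap F Z) : sphomotopic (spcomp (spcomp u f) g) u.
  apply: (@rst_trans _ _ _ (spcomp u (spcomp f g))).
    exact/rst_step/sphomotopy_ext.
  apply: rst_trans (sphomotopic_compl u fg) _.
  exact/rst_step/sphomotopy_ext.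
split=> [w|u v uv].
  exists (spcomp w g); apply: (@rst_trans _ _ _ (spcomp w (spcomp g f))).
    exact/rst_step/sphomotopy_ext.
  apply: rst_trans (sphomotopic_compl w gf) _.
  exact/rst_step/sphomotopy_ext.
apply: rst_trans (rst_sym _ _ _ _ (cancel u)) _.
exact: rst_trans (sphomotopic_compr g uv) (cancel v).
Qed.

Lemma homotopy_inverse_equivalent (E F : spectrum) (f : spmap E F) (g : spmap F E) :
  sphomotopic (spcomp g f) (spid E) -> sphomotopic (spcomp f g) (spid F) ->
  spectra_equivalent E F.
Proof. by move=> gf fg; apply: rst_step; exists f; apply: homotopy_inverse_stable fg. Qed.

End HomotopyEquivalence.

(** * Isomorphisms, exactness and functors for preadditive categories *)

Section Preadditive.
Variable A : addcat.

Definition aiso (X Y : A) (f : ahom X Y) (g : ahom Y X) : Prop :=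
  acomp g f = aid X /\ acomp f g = aid Y.

Lemma aiso_id X : aiso (aid X) (aid X).
Proof. by split; rewrite acomp1l. Qed.

Lemma aisoC (X Y : A) (f : ahom X Y) g : aiso f g -> aiso g f.
Proof. by case. Qed.

Lemma aiso_comp (X Y Z : A) (f : ahom X Y) f' (g : ahom Y Z) g' :
  aiso f f' -> aiso g g' -> aiso (acomp g f) (acomp f' g').
Proof.
move=> [f1 f2] [g1 g2]; split.
  by rewrite acompA -(acompA f') g1 acomp1r f1.
by rewrite acompA -(acompA g) f2 acomp1r g2.
Qed.

Lemma acompKl (X Y W : A) (f : ahom X Y) g (h : ahom W X) :
  aiso f g -> acomp g (acomp f h) = h.
Proof. by case=> e _; rewrite acompA e acomp1l. Qed.

Lemma acompKr (X Y W : A) (f : ahom X Y) g (h : ahom Y W) :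
  aiso f g -> acomp (acomp h f) g = h.
Proof. by case=> _ e; rewrite -acompA e acomp1r. Qed.

Lemma acompr0 (X Y Z : A) (g : ahom Y Z) : acomp g (0 : ahom X Y) = 0.
Proof. by apply: (addrI (acomp g 0)); rewrite -acompDr !addr0. Qed.

Lemma acompl0 (X Y Z : A) (f : ahom X Y) : acomp (0 : ahom Y Z) f = 0.
Proof. by apply: (addrI (acomp 0 f)); rewrite -acompDl !addr0. Qed.

Lemma aiso_zero (X Y : A) :
  aid X = 0 -> aid Y = 0 -> aiso (0 : ahom X Y) (0 : ahom Y X).
Proof. by move=> X0 Y0; split; rewrite acompr0 ?X0 ?Y0. Qed.

(** A test map into [Y'] is moved to [Y] by [j'], factored through [f] there, and the factor is
    moved to [X'] by [i]. Cokernels follow by passing to the opposite category. *)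
Lemma is_kernel_aiso (X Y Z X' Y' Z' : A) (f : ahom X Y) (g : ahom Y Z)
    (i : ahom X X') i' (j : ahom Y Y') j' (l : ahom Z Z') l' :
  aiso i i' -> aiso j j' -> aiso l l' -> is_kernel g f ->
  is_kernel (acomp (acomp l g) j') (acomp (acomp j f) i').
Proof.
move=> ii jj ll [gf univ]; split=> [|W h gh].
  by rewrite !acompA (acompKr _ (aisoC jj)) -(acompA l) gf acompr0 acompl0.
have [u [fu uniq]] : exists! u, acomp f u = acomp j' h.
  by apply: univ; rewrite -[LHS](acompKl _ ll) (acompA l) (acompA _ _ h) gh acompr0.
exists (acomp i u); split=> [|v fv].
  by rewrite -!acompA (acompKl _ ii) fu (acompKl _ (aisoC jj)).
rewrite (uniq (acomp i' v)) ?(acompKl _ (aisoC ii)) //.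
by rewrite -fv -!acompA (acompKl _ jj).
Qed.

End Preadditive.

Definition opcat (A : addcat) : addcat :=
  @AddCat A (fun X Y => ahom Y X) (fun X => aid X) (fun X Y Z g f => acomp f g)
    (fun X Y Z T h g f => esym (acompA f g h)) (fun X Y f => acomp1r f)
    (fun X Y f => acomp1l f) (fun X Y Z g g' f => acompDr f g g')
    (fun X Y Z g f f' => acompDl f f' g) (azero A) (azeroP A).

(** Passing to [opcat A] exchanges kernels and cokernels by mere unfolding. *)
Lemma short_exact_op (A : addcat) (X Y Z : A) (f : ahom X Y) (g : ahom Y Z) :
  short_exact f g -> @short_exact (opcat A) Z Y X g f.
Proof. by case. Qed.

Lemma short_exact_aiso (A : addcat) (X Y Z X' Y' Z' : A)
    (f : ahom X Y) (g : ahom Y Z)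
    (i : ahom X X') i' (j : ahom Y Y') j' (l : ahom Z Z') l' :
  aiso i i' -> aiso j j' -> aiso l l' -> short_exact f g ->
  short_exact (acomp (acomp j f) i') (acomp (acomp l g) j').
Proof.
move=> ii jj ll [kgf cfg]; split; first exact: is_kernel_aiso ii jj ll kgf.
rewrite -!acompA.
exact: (@is_kernel_aiso (opcat A) Z Y X Z' Y' X' g f l' l j' j i' i).
Qed.

Record addfun (A B : addcat) := AddFun {
  fobj :> A -> B;
  fmap : forall X Y, ahom X Y -> ahom (fobj X) (fobj Y);
  fmap1 : forall X, fmap (aid X) = aid (fobj X);
  fmapM : forall X Y Z (g : ahom Y Z) (f : ahom X Y),
    fmap (acomp g f) = acomp (fmap g) (fmap f);
  fmapD : forall X Y (f g : ahom X Y), fmap (f + g) = fmap f + fmap g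
}.

Section Functor.
Variables A B : addcat.
Implicit Type F : addfun A B.

Definition opfun F : addfun (opcat A) (opcat B) :=
  @AddFun (opcat A) (opcat B) F (fun X Y f => fmap F f) (fmap1 F)
    (fun X Y Z g f => fmapM F f g) (fun X Y f g => fmapD F f g).

Definition full F := forall X Y (h : ahom (F X) (F Y)), exists f, fmap F f = h.
Definition faithful F := forall X Y, injective (@fmap _ _ F X Y).
Definition essentially_surjective F :=
  forall Y, exists X (i : ahom (F X) Y) j, aiso i j.
Definition exact F := forall X Y Z (f : ahom X Y) (g : ahom Y Z),
  short_exact f g -> short_exact (fmap F f) (fmap F g).

Lemma fmap0 F X Y : fmap F (0 : ahom X Y) = 0.
Proof. by apply: (addrI (fmap F 0)); rewrite -fmapD !addr0. Qed.

Lemma fobj_zero F X : aid X = 0 -> aid (F X) = 0.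
Proof. by rewrite -fmap1 => ->; rewrite fmap0. Qed.

Lemma faithful_aiso F X Y (f : ahom X Y) g :
  faithful F -> aiso (fmap F f) (fmap F g) -> aiso f g.
Proof. by move=> ffF [gf fg]; split; apply: ffF; rewrite fmapM fmap1. Qed.

End Functor.

(** Up to isomorphism every test object is some [F V]. There fullness lifts the test map to [A], and
    faithfulness lifts the equations needed for existence and uniqueness of the factor. *)
Lemma fmap_kernel (A B : addcat) (F : addfun A B) X Y Z (f : ahom X Y) (g : ahom Y Z) :
  full F -> faithful F -> essentially_surjective F ->
  is_kernel g f -> is_kernel (fmap F g) (fmap F f).
Proof.
move=> fuF faF esF [gf univ]; split=> [|W h gh]; first by rewrite -fmapM gf fmap0.
have [V [i [j ij]]] := esF W; have [h' h'E] := fuF _ _ (acomp h i).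
have [u [fu uniq]] : exists! u, acomp f u = h'.
  by apply: univ; apply: faF; rewrite fmapM h'E acompA gh acompl0 fmap0.
exists (acomp (fmap F u) j); split=> [|v fv].
  by rewrite acompA -fmapM fu h'E (acompKr _ ij).
have [v' v'E] := fuF _ _ (acomp v i).
rewrite (uniq v') ?v'E ?(acompKr _ ij) //.
by apply: faF; rewrite fmapM v'E acompA fv.
Qed.

Lemma equivalence_exact (A B : addcat) (F : addfun A B) :
  full F -> faithful F -> essentially_surjective F -> exact F.
Proof.
move=> fuF faF esF X Y Z f g [kgf cfg]; split; first exact: fmap_kernel.
apply: (@fmap_kernel _ _ (opfun F) Z Y X g f) => //.
- by move=> X' Y' h; apply: fuF.
- by move=> X' Y'; apply: faF.
- by move=> W; have [V [i [j ij]]] := esF W; exists V, j, i.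
Qed.

(** * Functoriality of K-theory *)

Section MapDiagram.
Variables (A B : addcat) (F : addfun A B).
Hypotheses (F0 : F (azero A) = azero B) (exF : exact F).

(** Diagrams take the chosen zero object itself, not just some zero object, at empty sets and at
    trivial intervals; hence the strict condition [F0]. *)
Definition mapdiag J (le : rel J) (T : finType) (S : {set T}) (X : sumdiag A le S) :
  sumdiag B le S.
Proof.
exists (fun x => F (dobj X x)) (fun x y R h => fmap F (dmap X h)).
- by move=> x h; rewrite dmap_id fmap1.
- by move=> x y z R R' h h' h''; rewrite -fmapM -dmap_comp.
- by move=> x y R R' h h' h'' d; rewrite -fmapD -dmap_add.
- by move=> x x0; rewrite dobj_set0.
- by move=> x x0; rewrite dobj_diag.
- by move=> x y z h h' *; apply: exF; apply: dmap_exact.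
Defined.

Lemma mapdiag_reindex J J' (le : rel J) (le' : rel J') (T T' : finType)
    (S : {set T}) (S' : {set T'}) (r : reidx le le' S S') (X : sumdiag A le S) :
  mapdiag (reindex r X) = reindex r (mapdiag X).
(* Objects and maps agree by computation, and [sumcore_inj] disposes of the proof fields. *)
Proof. exact: sumcore_inj. Qed.

Lemma mapdiag0 J (le : rel J) (T : finType) (S : {set T}) :
  mapdiag (sumdiag0 A le S) = sumdiag0 B le S.
Proof. exact: sumdiag_eq0. Qed.

Definition kmap : spmap (ktheory A) (ktheory B).
Proof.
exists (fun n => match n return smap (klevel A n) (klevel B n) with
  | 0 => @SMap (point) (point) (fun p => id) (fun _ _ _ _ => erefl)
  | m.+1 => @SMap (kspace A m) (kspace B m)
      (fun p X => mapdiag X) (fun p q a X => mapdiag_reindex _ X)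
  end).
- by move=> [|n] p //=; apply: mapdiag0.
- move=> [|n] p c x /=; [exact: mapdiag0|exact: mapdiag_reindex].
Defined.

End MapDiagram.

(** * Homotopies from natural isomorphisms *)

Section NaturalIsomorphism.
Variables (A B : addcat) (F G : addfun A B).
Hypotheses (F0 : F (azero A) = azero B) (exF : exact F).
Hypotheses (G0 : G (azero A) = azero B) (exG : exact G).
Variables (i : forall X, ahom (F X) (G X)) (j : forall X, ahom (G X) (F X)).
Hypothesis ij : forall X, aiso (i X) (j X).
Hypothesis nat : forall X Y (f : ahom X Y),
  acomp (i Y) (fmap F f) = acomp (fmap G f) (i X).

Definition mixobj (b : bool) X : B := if b then G X else F X.
Definition mixto b X : ahom (F X) (mixobj b X) :=
  if b return ahom (F X) (mixobj b X) then i X else aid (F X).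
Definition mixfrom b X : ahom (mixobj b X) (F X) :=
  if b return ahom (mixobj b X) (F X) then j X else aid (F X).

Lemma mix_aiso b X : aiso (mixto b X) (mixfrom b X).
Proof. by case: b => //=; apply: aiso_id. Qed.

Section Mix.
Variables (J : Type) (le : rel J) (T : finType) (S : {set T}).
Variable b : J -> bool.

(* The maps of the diagram are conjugated by isomorphisms, so the choice between
   F and G at each index x may depend on itgt x in any way. *)
Definition mixcore (X : sumdiag A le S) :
    {o : sumidx le S -> B & forall x y R, sumhom x y R -> ahom (o x) (o y)} :=
  existT _ (fun x => mixobj (b (itgt x)) (dobj X x))
    (fun x y R h => acomp (acomp (mixto (b (itgt y)) (dobj X y))
      (fmap F (dmap X h))) (mixfrom (b (itgt x)) (dobj X x))).

Lemma mixobj0 c : mixobj c (azero A) = azero B.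
Proof. by case: c. Qed.

Definition mixdiag (X : sumdiag A le S) : sumdiag B le S.
Proof.
exists (projT1 (mixcore X)) (projT2 (mixcore X)) => /=.
- by move=> x h; rewrite dmap_id fmap1 acomp1r; case: (mix_aiso (b (itgt x)) (dobj X x)).
- move=> x y z R R' h h' h''.
  by rewrite (dmap_comp X h h' h'') fmapM !acompA (acompKr _ (aisoC (mix_aiso _ _))).
- move=> x y R R' h h' h'' d.
  by rewrite (dmap_add X h h' h'' d) fmapD acompDr acompDl.
- by move=> x x0; rewrite dobj_set0 // mixobj0.
- by move=> x x0; rewrite dobj_diag // mixobj0.
- move=> x y z h h' *.
  apply: short_exact_aiso (mix_aiso _ _) (mix_aiso _ _) (mix_aiso _ _) _.
  exact/exF/dmap_exact.
Defined.

Lemma mixdiag0 : mixdiag (sumdiag0 A le S) = sumdiag0 B le S.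
Proof. by apply: sumdiag_eq0 => x; apply: mixobj0. Qed.

End Mix.

Lemma mixdiag_reindex J J' (le : rel J) (le' : rel J') (T T' : finType)
    (S : {set T}) (S' : {set T'}) (r : reidx le le' S S') b b' (X : sumdiag A le S) :
  b' =1 b \o rord r -> mixdiag b' (reindex r X) = reindex r (mixdiag b X).
Proof. by move=> /funext ->; apply: sumcore_inj. Qed.

Lemma mixdiag_false J (le : rel J) (T : finType) (S : {set T}) b (X : sumdiag A le S) :
  b =1 xpred0 -> mixdiag b X = mapdiag F0 exF X.
Proof.
move=> /funext ->; apply: sumcore_inj; congr existT.
do 3!apply: functional_extensionality_dep => ?; apply: funext => h.
by rewrite /= acomp1r acomp1l.
Qed.

(** By naturality, conjugating [fmap F f] by [i] and [j] gives [fmap G f]. *)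
Lemma mixdiag_true J (le : rel J) (T : finType) (S : {set T}) b (X : sumdiag A le S) :
  b =1 xpredT -> mixdiag b X = mapdiag G0 exG X.
Proof.
move=> /funext ->; apply: sumcore_inj; congr existT.
do 3!apply: functional_extensionality_dep => ?; apply: funext => h.
by rewrite /= nat (acompKr _ (ij _)).
Qed.

Definition vertex p (x : doubled p) : 'I_p.+1 :=
  match x with inl i | inr i => i end.

(** The simplex [c] is read on both halves of [p]^op * [p]. The result is in general not monotone
    along that order, which is harmless because [mixdiag] accepts any Boolean function. *)
Definition side p (c : simp p 1) (x : doubled p) : bool := val c (vertex x) == ord_max.

Lemma side_comp p q (a : simp p q) c x :
  side (simp_comp c a) x = side c (doubled_act a x).
Proof. by rewrite /side mksimpE; case: x. Qed.

Lemma side_const p v (x : doubled p) : side (simp_const p v) x = (v == ord_max).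
Proof. by rewrite /side mksimpE. Qed.

Lemma kmap_natural : sphomotopic (kmap F0 exF) (kmap G0 exG).
Proof.
apply: rst_step.
exists (fun n => match n return forall p, klevel A n p -> simp p 1 -> klevel B n p with
  | 0 => fun p _ _ => tt
  | m.+1 => fun p X c => mixdiag (side c) X
  end); split=> [[|n] p q a X c|[|n] p c|[|n] p c X d|[|n] p []|[|n] p []] //=.
- by apply: mixdiag_reindex => x; rewrite side_comp.
- exact: mixdiag0.
- exact: mixdiag0.
(* The bonding map reindexes only the sets, so the choice between [F] and [G] stays the same. *)
- exact: mixdiag_reindex.
- by move=> *; apply: mixdiag_false => x; rewrite side_const.
- by move=> *; apply: mixdiag_true => x; rewrite side_const eqxx.
Qed.

End NaturalIsomorphism.

(** * K-theory of the opposite category *)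

Lemma dmap_eqset (A : addcat) J (le : rel J) (T : finType) (S : {set T})
    (X : sumdiag A le S) x y R R' (h : sumhom x y R) (h' : sumhom x y R') :
  R = R' -> dmap X h = dmap X h'.
Proof. by move=> e; subst R'; congr dmap; apply: bool_irrelevance. Qed.

(* [p]^op * [p] is its own opposite, naturally in p. *)
Section SwapIndex.
Variables (p : nat) (T : finType) (S : {set T}).

Definition swap (x : doubled p) : doubled p :=
  match x with inl i => inr i | inr i => inl i end.

Lemma swapK : involutive swap. Proof. by case. Qed.

Lemma swap_le x y : doubled_le x y -> doubled_le (swap y) (swap x).
Proof. by case: x y => i [] j. Qed.

Definition swapidx (x : sumidx (@doubled_le p) S) : sumidx (@doubled_le p) S :=
  SumIdx (isetP x) (swap_le (ileP x)).

Lemma swapidxK : involutive swapidx.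
Proof. by move=> x; apply: sumidx_eq; rewrite /= ?swapK. Qed.

Lemma swapidx_hom x y R : sumhom x y R -> sumhom (swapidx y) (swapidx x) R.
Proof. by case/and4P => Rx Ry s t; apply/and4P; split=> //; apply: swap_le. Qed.

Variable A : addcat.

Definition opdiag (X : sumdiag A (@doubled_le p) S) :
  sumdiag (opcat A) (@doubled_le p) S.
Proof.
exists (fun x => dobj X (swapidx x) : opcat A)
  (fun x y R h => dmap X (swapidx_hom h)).
- by move=> x h; apply: dmap_id.
- move=> x y z R R' h h' h''; move: (swapidx_hom h''); rewrite finset.setIC => k.
  exact: dmap_comp.
- by move=> x y R R' h h' h'' d; apply: dmap_add.
- by move=> x e; exact: (@dobj_set0 _ _ _ _ _ X (swapidx x)).
- by move=> x e; apply: (@dobj_diag _ _ _ _ _ X (swapidx x)); rewrite /= e.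
- move=> x y z h h' e1 e2 e3 e4 e5; apply: short_exact_op.
  (* [dmap_exact] expects each map to be labelled by the set of its source. Swapping exchanges
     source and target, so the labels are rewritten along the equality of these sets. *)
  have k : sumhom (swapidx y) (swapidx x) (iset (swapidx y)).
    by move: (swapidx_hom h); rewrite e1.
  have k' : sumhom (swapidx z) (swapidx y) (iset (swapidx z)).
    by move: (swapidx_hom h'); rewrite e2.
  rewrite (dmap_eqset X (swapidx_hom h) k e1) (dmap_eqset X (swapidx_hom h') k' e2).
  by apply: dmap_exact; rewrite /= ?e1 ?e2 ?e3 ?e4 ?e5.
Defined.

End SwapIndex.

Lemma doubled_act_swap p q (a : simp p q) x :
  doubled_act a (swap x) = swap (doubled_act a x).
Proof. by case: x. Qed.

Section OpCore.
Variables (A : addcat) (J J' : Type) (le : rel J) (le' : rel J') (T T' : finType).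
Variables (S : {set T}) (S' : {set T'}) (X : sumdiag A le S).
Implicit Type f : sumidx le' S' -> sumidx le S.
Implicit Type g : {set T'} -> {set T}.

(** The contravariant counterpart of [pullcore]. *)
Definition opcore f g
    (H : forall x y R, sumhom x y R -> sumhom (f y) (f x) (g R)) :
    {o : sumidx le' S' -> opcat A & forall x y R, sumhom x y R -> ahom (o x) (o y)} :=
  existT _ (fun x => dobj X (f x) : opcat A) (fun x y R h => dmap X (H x y R h)).

Lemma opcore_ext f f' g g' H H' :
  f =1 f' -> g =1 g' -> @opcore f g H = @opcore f' g' H'.
Proof.
move=> /funext ef /funext eg; subst f' g'.
by congr opcore; apply: Prop_irrelevance.
Qed.

End OpCore.

Section OpTheory.
Variable A : addcat.

Lemma opdiag_reindex p q (T T' : finType) (S : {set T}) (S' : {set T'})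
    (r : reidx (@doubled_le p) (@doubled_le q) S S') (X : sumdiag A (@doubled_le p) S) :
  (forall x, rord r (swap x) = swap (rord r x)) ->
  opdiag (reindex r X) = reindex r (opdiag X).
Proof.
move=> rswap; apply: sumcore_inj.
apply: (opcore_ext X (fun x y R h => ridx_hom r (swapidx_hom h))
  (fun x y R h => swapidx_hom (ridx_hom r h))) => // x.
by apply: sumidx_eq; rewrite /= ?rswap.
Qed.

Lemma opdiag0 p (T : finType) (S : {set T}) :
  opdiag (sumdiag0 A (@doubled_le p) S) = sumdiag0 (opcat A) _ S.
Proof. exact: sumdiag_eq0. Qed.

Definition kop : spmap (ktheory A) (ktheory (opcat A)).
Proof.
exists (fun n => match n return smap (klevel A n) (klevel (opcat A) n) with
  | 0 => @SMap point point (fun p => id) (fun _ _ _ _ => erefl)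
  | m.+1 => @SMap (kspace A m) (kspace (opcat A) m)
      (fun p X => opdiag X)
      (fun p q a X =>
         @opdiag_reindex q p _ _ _ _ (act_idx m a) X (@doubled_act_swap p q a))
  end).
- by move=> [|n] p //=; apply: opdiag0.
- by move=> [|n] p c x /=; [apply: opdiag0|apply: opdiag_reindex].
Defined.

(** The double opposite has the data of [A] but other proofs of the laws, so an identity-like
    functor is needed to return to [A]. *)
Definition unop : addfun (opcat (opcat A)) A :=
  @AddFun (opcat (opcat A)) A id (fun X Y f => f) (fun X => erefl)
    (fun X Y Z g f => erefl) (fun X Y f g => erefl).

Lemma unop_exact : exact unop.
Proof. by []. Qed.

End OpTheory.

(** As [swap] is an involution, reversing a diagram twice restores its data, so both composites are
    pointwise the identity. *)
Lemma ktheory_op (A : addcat) : spectra_equivalent (ktheory A) (ktheory (opcat A)).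
Proof.
pose back := spcomp (kmap (erefl : unop A (azero (opcat (opcat A))) = azero A)
  (@unop_exact A)) (kop (opcat A)).
have twice (D : addcat) p (T : finType) (S : {set T}) (X : sumdiag D (@doubled_le p) S) :
    pullcore X (fun x y R h => swapidx_hom (swapidx_hom h)) = sumcore X.
  apply: (pullcore_ext X (fun x y R h => swapidx_hom (swapidx_hom h))
    (fun x y R h => h)) => // x; exact: swapidxK.
apply: (@homotopy_inverse_equivalent _ _ (kop A) back);
  apply/rst_step/sphomotopy_ext => -[|n] p X.
- by case: X.
- by apply: sumcore_inj; apply: twice.
- by case: X.
- by apply: sumcore_inj; apply: twice.
Qed.

(** * Equivalences of categories and K-theory *)

Section Equivalence.
Variables A B : addcat.

Section Conjugate.
Variables (F : addfun A B) (P : A -> B).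
Variables (i : forall X, ahom (F X) (P X)) (j : forall X, ahom (P X) (F X)).
Hypothesis ij : forall X, aiso (i X) (j X).

(** Replacing the values of [F] by isomorphic objects [P X] makes it possible to correct the value
    at the zero object. *)
Definition conjfun : addfun A B.
Proof.
exists P (fun X Y f => acomp (acomp (i Y) (fmap F f)) (j X)).
- by move=> X; rewrite fmap1 acomp1r; case: (ij X).
- by move=> X Y Z g f; rewrite fmapM !acompA (acompKr _ (aisoC (ij _))).
- by move=> X Y f g; rewrite fmapD acompDr acompDl.
Defined.

Lemma conjfun_full : full F -> full conjfun.
Proof.
move=> fuF X Y h; have [f fE] := fuF _ _ (acomp (acomp (j Y) h) (i X)).
exists f; rewrite /= fE !acompA (acompKr _ (ij X)).
by case: (ij Y) => _ ->; rewrite acomp1l.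
Qed.

Lemma conjfun_faithful : faithful F -> faithful conjfun.
Proof.
move=> faF X Y f g /(congr1 (fun h => acomp (acomp (j Y) h) (i X))) /=.
rewrite !acompA -!acompA !(acompKl _ (ij Y)).
case: (ij X) => -> _; rewrite !acomp1r; exact: faF.
Qed.

Lemma conjfun_ess : essentially_surjective F -> essentially_surjective conjfun.
Proof.
move=> esF Y; have [X [u [v uv]]] := esF Y.
exists X, (acomp u (j X)), (acomp (i X) v).
exact: aiso_comp (aisoC (ij X)) uv.
Qed.

End Conjugate.

Variable F : addfun A B.
Hypotheses (fuF : full F) (faF : faithful F).

Section Inverse.
Variable P : B -> A.
Variables (i : forall Y, ahom (F (P Y)) Y) (j : forall Y, ahom Y (F (P Y))).
Hypothesis ij : forall Y, aiso (i Y) (j Y).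

Definition preim X Y (h : ahom (F X) (F Y)) : ahom X Y := sval (cid (fuF h)).

Lemma fmap_preim X Y (h : ahom (F X) (F Y)) : fmap F (preim h) = h.
Proof. exact: svalP (cid (fuF h)). Qed.

(** The quasi-inverse of [F]: fullness supplies the morphisms, and the functor laws are checked
    after applying the faithful [F]. *)
Definition invfun : addfun B A.
Proof.
exists P (fun X Y h => preim (acomp (acomp (j Y) h) (i X))).
- by move=> X; apply: faF; rewrite fmap_preim fmap1 acomp1r; case: (ij X).
- move=> X Y Z g f; apply: faF.
  by rewrite fmapM !fmap_preim !acompA (acompKr _ (ij _)).
- by move=> X Y f g; apply: faF; rewrite fmapD !fmap_preim acompDr acompDl.
Defined.

Lemma fmap_invfun X Y (h : ahom X Y) :
  fmap F (fmap invfun h) = acomp (acomp (j Y) h) (i X).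
Proof. exact: fmap_preim. Qed.

Lemma invfun_full : full invfun.
Proof.
move=> X Y h; exists (acomp (acomp (i Y) (fmap F h)) (j X)); apply: faF.
rewrite fmap_invfun !acompA (acompKr _ (aisoC (ij X))).
by case: (ij Y) => -> _; rewrite acomp1l.
Qed.

Lemma invfun_faithful : faithful invfun.
Proof.
move=> X Y f g /(congr1 (fun h => acomp (acomp (i Y) (fmap F h)) (j X))).
rewrite !fmap_invfun -!acompA !(acompKl _ (aisoC (ij Y))).
by case: (ij X) => _ ->; rewrite !acomp1r.
Qed.

Definition unit_to X : ahom (invfun (F X)) X := preim (i (F X)).
Definition unit_from X : ahom X (invfun (F X)) := preim (j (F X)).

Lemma unit_aiso X : aiso (unit_to X) (unit_from X).
Proof. by apply: (@faithful_aiso _ _ F) => //; rewrite !fmap_preim. Qed.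

Lemma invfun_ess : essentially_surjective invfun.
Proof. by move=> X; exists (F X), (unit_to X), (unit_from X); apply: unit_aiso. Qed.

End Inverse.
End Equivalence.

Definition addid (A : addcat) : addfun A A :=
  @AddFun A A id (fun X Y f => f) (fun X => erefl)
    (fun X Y Z g f => erefl) (fun X Y f g => erefl).

Definition addcomp (A B D : addcat) (G : addfun B D) (F : addfun A B) : addfun A D.
Proof.
exists (fun X => G (F X)) (fun X Y f => fmap G (fmap F f)).
- by move=> X; rewrite !fmap1.
- by move=> X Y Z g f; rewrite !fmapM.
- by move=> X Y f g; rewrite !fmapD.
Defined.

(** [kmap_natural] compares the composite functor with the identity functor; the remaining two
    identifications hold pointwise. *)
Lemma kmap_inverse (A B : addcat) (F : addfun A B) (G : addfun B A)
    (F0 : F (azero A) = azero B) (exF : exact F)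
    (G0 : G (azero B) = azero A) (exG : exact G)
    (i : forall X, ahom (G (F X)) X) (j : forall X, ahom X (G (F X))) :
  (forall X, aiso (i X) (j X)) ->
  (forall X Y (f : ahom X Y), acomp (i Y) (fmap G (fmap F f)) = acomp f (i X)) ->
  sphomotopic (spcomp (kmap G0 exG) (kmap F0 exF)) (spid (ktheory A)).
Proof.
move=> ij nat.
have GF0 : addcomp G F (azero A) = azero A by rewrite /= F0.
have exGF : exact (addcomp G F) by move=> X Y Z f g /exF /exG.
have id0 : addid A (azero A) = azero A by [].
have exid : exact (addid A) by [].
apply: (@rst_trans _ _ _ (kmap GF0 exGF)).
  apply/rst_step/sphomotopy_ext => -[|n] p X; first by case: X.
  exact: sumcore_inj.
apply: (@rst_trans _ _ _ (kmap id0 exid)).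
  exact: (@kmap_natural _ _ (addcomp G F) (addid A) GF0 exGF id0 exid i j).
apply/rst_step/sphomotopy_ext => -[|n] p X; first by case: X.
exact: sumcore_inj.
Qed.

Lemma strict_equivalence_ktheory (A B : addcat) (F : addfun A B) :
  F (azero A) = azero B -> full F -> faithful F -> essentially_surjective F ->
  spectra_equivalent (ktheory A) (ktheory B).
Proof.
move=> F0 fuF faF esF.
(* Preimages are chosen so that [azero B] gets [azero A]; the quasi-inverse then also preserves zero
   strictly. *)
have pre Y : exists t : {X : A & (ahom (F X) Y * ahom Y (F X))%type},
    aiso (projT2 t).1 (projT2 t).2 /\ (Y = azero B -> projT1 t = azero A).
  have [->|Y0] := pselect (Y = azero B).
    have ? := fobj_zero F (azeroP A).
    by exists (existT _ (azero A) (0, 0)); split=> //; apply: aiso_zero => //; apply: azeroP.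
  by have [X [i [j ij]]] := esF Y; exists (existT _ X (i, j)).
pose t Y := sval (cid (pre Y)).
pose i Y : ahom (F (projT1 (t Y))) Y := (projT2 (t Y)).1.
pose j Y : ahom Y (F (projT1 (t Y))) := (projT2 (t Y)).2.
have ij Y : aiso (i Y) (j Y) by case: (svalP (cid (pre Y))).
have G0 : invfun fuF faF ij (azero B) = azero A.
  by case: (svalP (cid (pre (azero B)))) => _; apply.
have exF : exact F by apply: equivalence_exact.
have exG : exact (invfun fuF faF ij).
  apply: equivalence_exact.
  - exact: invfun_full.
  - exact: invfun_faithful.
  - exact: invfun_ess.
apply: (@homotopy_inverse_equivalent _ _ (kmap F0 exF) (kmap G0 exG)).
- apply: (kmap_inverse _ _ _ _ (unit_aiso fuF faF ij)) => X Y f.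
  by apply: (faF _ _); rewrite !fmapM fmap_invfun !fmap_preim !acompA;
    case: (ij (F Y)) => _ ->; rewrite acomp1l.
- apply: (@kmap_inverse _ _ (invfun fuF faF ij) F G0 exG F0 exF i j ij) => X Y f.
  by rewrite fmap_invfun !acompA; case: (ij Y) => _ ->; rewrite acomp1l.
Qed.

Lemma equivalence_ktheory (A B : addcat) (F : addfun A B) :
  full F -> faithful F -> essentially_surjective F ->
  spectra_equivalent (ktheory A) (ktheory B).
Proof.
move=> fuF faF esF.
(* The value of [F] is changed only at [azero A], where it is a zero object and hence isomorphic to
   [azero B]. *)
have strict X : exists t : {Y : B & (ahom (F X) Y * ahom Y (F X))%type},
    aiso (projT2 t).1 (projT2 t).2 /\ (X = azero A -> projT1 t = azero B).
  have [->|X0] := pselect (X = azero A).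
    have ? := fobj_zero F (azeroP A).
    by exists (existT _ (azero B) (0, 0)); split=> //; apply: aiso_zero => //; apply: azeroP.
  by exists (existT _ (F X) (aid _, aid _)); split=> //; apply: aiso_id.
pose t X := sval (cid (strict X)).
pose i X : ahom (F X) (projT1 (t X)) := (projT2 (t X)).1.
pose j X : ahom (projT1 (t X)) (F X) := (projT2 (t X)).2.
have ij X : aiso (i X) (j X) by case: (svalP (cid (strict X))).
apply: (@strict_equivalence_ktheory _ _ (conjfun ij)).
- by case: (svalP (cid (strict (azero A)))) => _; apply.
- exact: conjfun_full.
- exact: conjfun_faithful.
- exact: conjfun_ess.
Qed.

(** * Transposition of linear maps *)

Section Transpose.
Import VectorInternalTheory.
Variable k : fieldType.
Implicit Types U V W : vectType k.

(* Matrices are transposed in a fixed basis, rather than dual spaces formed, so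
   that transposition keeps the space and is strictly involutive. *)
Definition trlfun V W (f : 'Hom(V, W)) : 'Hom(W, V) := Hom (f2mx f)^T.

Lemma HomE V W (M : 'M_(_, _)) (v : V) : (Hom M : 'Hom(V, W)) v = r2v (v2r v *m M).
Proof. by rewrite unlock. Qed.

Lemma HomP V W (f : 'Hom(V, W)) M : (forall v, f v = r2v (v2r v *m M)) -> f = Hom M.
Proof. by move=> e; apply/lfunP => v; rewrite e HomE. Qed.

Lemma HomD V W a (M N : 'M_(_, _)) :
  (Hom (a *: M + N) : 'Hom(V, W)) = a *: Hom M + Hom N.
Proof.
apply: esym; apply: HomP => v.
by rewrite add_lfunE scale_lfunE !HomE mulmxDr -scalemxAr linearP.
Qed.

Lemma trlfunK V W (f : 'Hom(V, W)) : trlfun (trlfun f) = f.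
Proof. by case: f => M; rewrite /trlfun trmxK. Qed.

Lemma trlfun_linear V W : linear (@trlfun V W).
Proof.
by move=> a [M] [N]; rewrite -HomD /trlfun /= linearP HomD.
Qed.

HB.instance Definition _ V W :=
  GRing.isLinear.Build k 'Hom(V, W) 'Hom(W, V) *:%R (@trlfun V W) (@trlfun_linear V W).

Lemma trlfun_comp U V W (g : 'Hom(V, W)) (f : 'Hom(U, V)) :
  trlfun (g \o f)%VF = (trlfun f \o trlfun g)%VF.
Proof.
have compE (X Y Z : vectType k) (M : 'M_(_, _)) (N : 'M_(_, _)) :
    ((Hom N : 'Hom(Y, Z)) \o (Hom M : 'Hom(X, Y)))%VF = (Hom (M *m N) : 'Hom(X, Z)).
  by apply: HomP => v; rewrite comp_lfunE !HomE r2vK mulmxA.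
by case: f g => M [N]; rewrite compE /trlfun /= trmx_mul -compE.
Qed.

Lemma trlfun1 V : trlfun (\1 : 'End(V))%VF = \1%VF.
Proof.
have -> : (\1 : 'End(V))%VF = (Hom 1%:M : 'Hom(V, V)).
  by apply: HomP => v; rewrite id_lfunE mulmx1 v2rK.
by rewrite /trlfun /= trmx1.
Qed.

(** This embeds Hom spaces in the row spaces that [finite_codim] refers to. *)
Definition lfun_row V W (f : 'Hom(V, W)) : 'rV[k]_(_) := mxvec (f2mx f).

Lemma lfun_row_linear V W : linear (@lfun_row V W).
Proof. by move=> a [M] [N]; rewrite /lfun_row -HomD /= linearP. Qed.

HB.instance Definition _ V W :=
  GRing.isLinear.Build k 'Hom(V, W) 'rV[k]_(_) *:%R (@lfun_row V W)
    (@lfun_row_linear V W).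

Lemma lfun_row_inj V W : injective (@lfun_row V W).
Proof. by move=> [M] [N] /(can_inj mxvecK) /= ->. Qed.

End Transpose.

(** * Separating tensors by linear forms *)

Section Slices.
Variable k : fieldType.

Section Slice.
Variables V W : lmodType k.

(** [tfold (slice g)] is the map id (x) g from V (x) W to V. *)
Definition slice (g : W -> k^o) (v : V) (w : W) : V := g w *: v.

Fact slice_bilinear (g : {linear W -> k^o}) : bilinear_for *:%R *:%R (slice g).
Proof.
rewrite /slice; split=> [w a u v | v a u w] /=.
  by rewrite scalerDr !scalerA mulrC.
by rewrite linearP scalerDl -scalerA.
Qed.
HB.instance Definition _ (g : {linear W -> k^o}) :=
  bilinear_isBilinear.Build k V W V *:%R *:%R (slice g) (slice_bilinear g).

Lemma tensor_sum (t : tensor V W) : t = \sum_(p <- repr t) tens p.1 p.2.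
Proof.
apply: tensorP => U B; rewrite raddf_sum; apply: eq_bigr => p _.
exact/esym/tfold_tens.
Qed.

(* By induction on the length of a representation x (x) y + ... of t: if G i y is
   not 0, then slicing with G i expresses x in terms of the other summands. *)
Lemma tensor_separated (I : Type) (G : I -> {linear W -> k^o}) (t : tensor V W) :
  (forall w, (forall i, G i w = 0) -> w = 0) ->
  (forall i, tfold (slice (G i)) t = 0) -> t = 0.
Proof.
move=> sep t0; rewrite [t]tensor_sum.
have {t0} : forall i, \sum_(p <- repr t) slice (G i) p.1 p.2 = 0 by [].
move: (repr t) => s {t}; have [n] := ubnP (size s); elim: n s => // n IH [|[x y] s] sn st.
  by rewrite big_nil.
rewrite big_cons /=.
have [y0|/existsNP [i /eqP yi]] := pselect (forall i, G i y = 0).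
  rewrite (sep _ y0) linear0r add0r; apply: IH => [|i]; first exact: sn.
  by have := st i; rewrite big_cons /slice /= y0 scale0r add0r.
pose c (w : W) : k := G i w / G i y.
have xE : x = - \sum_(p <- s) c p.2 *: p.1.
  apply: (scalerI yi); rewrite scalerN scaler_sumr.
  apply/eqP; rewrite -addr_eq0; apply/eqP; apply: etrans (st i); rewrite big_cons.
  congr (_ + _); apply: eq_bigr => p _.
  by rewrite scalerA /c mulrC divfK.
(* Substituting [xE] spreads x (x) y over the other summands, which leaves a sum with one term
   less. *)
transitivity (\sum_(p <- [seq (p.1, p.2 - c p.2 *: y) | p <- s]) tens p.1 p.2).
  rewrite big_map xE linearNl linear_sumlz -sumrN -big_split /=.
  by apply: eq_bigr => p _; rewrite linearBr /= linearZl_LR linearZr_LR addrC.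
apply: IH; first by rewrite size_map.
move=> j; apply: etrans (st j); rewrite big_map big_cons.
rewrite [in RHS]/slice [in RHS]xE /= scalerN scaler_sumr.
rewrite -sumrN -big_split; apply: eq_bigr => p _ /=.
by rewrite /slice linearB linearZ_LR scalerBl addrC scalerA mulrC.
Qed.

End Slice.

Variables (V : lmodType k) (C : coalgType k).
Implicit Types (f g : dual C).

Lemma slice_conv f g (t : tensor V C) :
  tfold (slice (tfold (mulf f g))) (tmap id comul t) = tfold (slice (conv f g)) t.
Proof. exact: (tfold_tmap idfun comul (slice (tfold (mulf f g)))). Qed.

(** The last factor can be sliced by [g] before [d] is applied, since [d] acts on the first factor
    only and is linear. *)
Lemma slice_tassoc (d : {linear V -> tensor V C}) f g (t : tensor V C) :
  tfold (slice (tfold (mulf f g))) (tassoc (tmap d id t)) =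
  tfold (slice f) (d (tfold (slice g) t)).
Proof.
transitivity (tfold (bprecomp (slice g) (tfold (slice f)) idfun) (tmap d idfun t)).
  move: (tmap d _ t) => u.
  have -> : tassoc u = \sum_(p <- repr u) \sum_(q <- repr p.1)
      tens q.1 (tens q.2 p.2) by [].
  rewrite raddf_sum; apply: eq_bigr => p _ /=.
  rewrite raddf_sum /bprecomp [RHS]scaler_sumr; apply: eq_bigr => q _ /=.
  rewrite [LHS]tfold_tens.
  change (tfold (mulf f g) (tens q.2 p.2) *: q.1 = g p.2 *: (f q.2 *: q.1)).
  by rewrite tfold_tens scalerA [g _ * _]mulrC.
rewrite tfold_tmap; have -> : tfold (slice g) t = \sum_(p <- repr t) g p.2 *: p.1 by [].
rewrite !raddf_sum; apply: eq_bigr => p _.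
change (g p.2 *: tfold (slice f) (d p.1) = tfold (slice f) (d (g p.2 *: p.1))).
by rewrite !linearZ_LR.
Qed.

End Slices.

(** * The functor from comodules to modules *)

Section Comodules.
Variables (k : fieldType) (C : coalgType k).

Section Action.
Variables (V : vectType k) (d : {linear V -> tensor V C}).
Implicit Types f g : dual C.

(* The left C^*-module of a comodule: f . v is the sum of the f(v_1) v_0. *)
Definition lact f : 'End(V) := linfun (tfold (slice f) \o d).

Lemma lactE f v : lact f v = tfold (slice f) (d v).
Proof. exact: lfunE. Qed.

Lemma lact_linear : linear lact.
Proof.
move=> a f g; apply/lfunP => v; rewrite add_lfunE scale_lfunE !lactE.
rewrite /tfold /bsum scaler_sumr -big_split /=; apply: eq_bigr => p _.
by rewrite /slice scalerA -scalerDl.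
Qed.
HB.instance Definition _ :=
  GRing.isLinear.Build k (dual C) 'End(V) *:%R lact lact_linear.

End Action.

(** This is coassociativity of the coaction, sliced by f (x) g. *)
Lemma lact_conv (V : fdcomod C) (f g : dual C) :
  lact (coact V) (conv f g) = (lact (coact V) f \o lact (coact V) g)%VF.
Proof.
apply/lfunP => v; rewrite comp_lfunE !lactE.
by rewrite -slice_conv -coactA slice_tassoc.
Qed.

Lemma lact_counit (V : fdcomod C) : lact (coact V) (mkdual counit) = \1%VF.
Proof. by apply/lfunP => v; rewrite lactE id_lfunE; apply: coact1. Qed.

Definition tract (V : fdcomod C) (v : cospace V) (f : dual C) : cospace V :=
  trlfun (lact (coact V) f) v.

Fact tract_bilinear V : bilinear_for *:%R *:%R (@tract V).
Proof.
rewrite /tract; split=> [f a u v | v a f g] /=; first by rewrite linearP.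
by rewrite !linearP add_lfunE scale_lfunE.
Qed.
HB.instance Definition _ V :=
  bilinear_isBilinear.Build k (cospace V) (dual C) (cospace V) *:%R *:%R
    (@tract V) (@tract_bilinear V).

Fact tract1 V (v : cospace V) : tract v aone = v.
Proof. by rewrite /tract lact_counit trlfun1 id_lfunE. Qed.

Fact tractA V (v : cospace V) (f g : dual C) : tract (tract v f) g = tract v (amul f g).
Proof. by rewrite /tract [amul f g]/(conv f g) lact_conv trlfun_comp comp_lfunE. Qed.

Definition comod_module (V : fdcomod C) : fdmod (dual C) :=
  @FdMod _ _ (cospace V) (@tract V) (@tract1 V) (@tractA V).

Lemma comod_mor_lact (V W : fdcomod C) (h : 'Hom(cospace V, cospace W)) f :
  comod_mor h -> (lact (coact W) f \o h)%VF = (h \o lact (coact V) f)%VF.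
Proof.
move=> mh; apply/lfunP => v; rewrite !comp_lfunE !lactE mh.
rewrite [LHS](tfold_tmap h idfun (slice f)) /tfold /bsum raddf_sum /=.
by apply: eq_bigr => p _; rewrite /slice linearZ.
Qed.

Fact trlfun_mod_mor (V W : fdcomod C) (h : fdhom (D := fdcomod_struct C) V W) :
  mod_mor (V := comod_module W) (W := comod_module V) (trlfun h).
Proof.
move=> v f; rewrite /= /tract -!comp_lfunE -!trlfun_comp.
by rewrite comod_mor_lact //; move/asboolP: (fdhomP h).
Qed.

Definition trhom (V W : fdcomod C) (h : fdhom (D := fdcomod_struct C) V W) :
    fdhom (D := fdmod_struct (dual C)) (comod_module W) (comod_module V) :=
  @FdHom _ (fdmod_struct (dual C)) (comod_module W) (comod_module V) (trlfun h)
    (introT (asboolP _) (trlfun_mod_mor h)).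

Definition comod_dual : addfun (opcat (comod_cat C)) (mod_cat (dual C)).
Proof.
exists (fun V : opcat (comod_cat C) => comod_module V : mod_cat (dual C))
  (fun V W h => trhom h) => [V|V W U g f|V W f g]; apply: val_inj => /=.
- exact: trlfun1.
- exact: trlfun_comp.
- exact: linearD.
Defined.

Lemma comod_dual_faithful : faithful comod_dual.
Proof.
move=> V W f g /(congr1 (fun h => trlfun (fdfun h))) /=.
by rewrite !trlfunK => ?; apply: val_inj.
Qed.

Hypothesis sep : forall c : C, (forall f : dual C, f c = 0) -> c = 0.

Lemma dual_separated (V : lmodType k) (t : tensor V C) :
  (forall f : dual C, tfold (slice f) t = 0) -> t = 0.
Proof. exact: (@tensor_separated k V C (dual C) (fun f => f : {linear C -> k^o})). Qed.

(** The forms f (x) g separate the points of C (x) C: slice by [g], then evaluate [f] on the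
    result. *)
Lemma dual2_separated (V : lmodType k) (t : tensor V (tensor C C)) :
  (forall f g : dual C, tfold (slice (tfold (mulf f g))) t = 0) -> t = 0.
Proof.
move=> t0.
apply: (@tensor_separated k V (tensor C C) (dual C * dual C)
  (fun fg => tfold (mulf fg.1 fg.2))) => [w w0|fg]; last exact: t0.
apply: dual_separated => g; apply: sep => f.
apply: etrans (w0 (f, g)); rewrite [in LHS]/tfold /bsum raddf_sum.
apply: eq_bigr => p _.
by rewrite [LHS](dualZ f) [LHS]mulrC.
Qed.

(** The transpose of a module map commutes with all [lact f]. So the two sides of the comodule
    condition have equal slices, and these determine them. *)
Lemma comod_dual_full : full comod_dual.
Proof.
move=> V W h.
have mh : comod_mor (V := W) (W := V) (trlfun h).
  move=> v; apply/eqP; rewrite -subr_eq0; apply/eqP/dual_separated => f.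
  have mh : (h \o trlfun (lact (coact V) f))%VF = (trlfun (lact (coact W) f) \o h)%VF.
    by apply/lfunP => x; rewrite !comp_lfunE; move/asboolP: (fdhomP h); apply.
  rewrite linearB /= -lactE -comp_lfunE -[lact _ f]trlfunK -trlfun_comp mh.
  rewrite trlfun_comp trlfunK comp_lfunE lactE.
  rewrite (tfold_tmap (trlfun h) idfun (slice f)) {1}/tfold /bsum raddf_sum.
  rewrite -sumrB big1 // => p _.
  by rewrite /slice /= linearZ subrr.
exists (@FdHom _ (fdcomod_struct C) W V (trlfun h) (introT (asboolP _) mh)).
by apply: val_inj; rewrite /= trlfunK.
Qed.

End Comodules.

(** * Matrix coefficients of finite dimensional modules *)

Section RightModule.
Variables (k : fieldType) (A : unitalAlgType k) (M : fdmod A).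
Let V := modspace M.
Implicit Types f g : A.

Definition ract f : 'End(V) := linfun (applyr (mact M) f).

Lemma ractE f v : ract f v = mact M v f.
Proof. exact: lfunE. Qed.

Lemma ract_linear : linear ract.
Proof.
by move=> a f g; apply/lfunP => v; rewrite add_lfunE scale_lfunE !ractE linearPr.
Qed.
HB.instance Definition _ :=
  GRing.isLinear.Build k A 'End(V) *:%R ract ract_linear.

Lemma ractM f g : ract (amul f g) = (ract g \o ract f)%VF.
Proof. by apply/lfunP => v; rewrite comp_lfunE !ractE mactA. Qed.

Lemma ract1 : ract aone = \1%VF.
Proof. by apply/lfunP => v; rewrite ractE id_lfunE mact1. Qed.

Definition mcoef (l : dual V) (v : V) f : k^o := l (trlfun (ract f) v).

Fact mcoef_linear l v : linear (mcoef l v).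
Proof. by move=> a f g; rewrite /mcoef !linearP add_lfunE scale_lfunE linearP. Qed.
HB.instance Definition _ l v :=
  GRing.isLinear.Build k A k^o *:%R (mcoef l v) (mcoef_linear l v).

Lemma mcoef_finite_dual l v : in_finite_dual (mkdual (mcoef l v)).
Proof.
(* The annihilator is the kernel of [ract], whose values lie in the finite dimensional ['End(V)]. *)
apply/asboolP; exists [set f | ract f = 0]%classic; split.
- split=> [|a f g /= f0 g0|f g /= g0]; first exact: linear0.
    by rewrite linearP /= f0 g0 scaler0 addr0.
  by rewrite !ractM g0 comp_lfun0l comp_lfun0r.
- exists _, (@lfun_row k V V \o ract).
  apply/seteqP; split=> f /= f0.
    by rewrite f0 linear0.
  by apply: lfun_row_inj; rewrite f0 linear0.
- by move=> f /= f0; rewrite /mcoef f0 linear0 zero_lfunE linear0.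
Qed.

End RightModule.

(** * Comodules from modules over the dual of a coreflexive coalgebra *)

Section EssentialSurjectivity.
Variables (k : fieldType) (C : coalgType k).
Hypothesis reflC : coreflexive C.

Lemma coreflexive_separated (c : C) : (forall f : dual C, f c = 0) -> c = 0.
Proof.
have [e [eE eB _ _]] := reflC => c0.
apply: (bij_inj eB); rewrite linear0; apply: val_inj; apply: dualP => f.
exact: etrans (eE c f) (c0 f).
Qed.

Section ModuleToComodule.
Variable M : fdmod (dual C).
Let V := modspace M.
Implicit Types f g : dual C.

(** Surjectivity of the evaluation map turns a matrix coefficient, which lies in the finite dual,
    into an element of [C]. *)
Lemma mcoef_rep (l : dual V) v : exists c : C, forall f, f c = mcoef (M := M) l v f.
Proof.
have [e [eE [e' _ e'K] _ _]] := reflC.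
by exists (e' (FiniteDual (mcoef_finite_dual l v))) => f; rewrite -eE e'K.
Qed.

Lemma ract_lact : exists d : {linear V -> tensor V C},
  forall f, lact d f = trlfun (ract M f).
Proof.
pose X := vbasis {:V}.
have coord_lin i : linear (coord X i : V -> k^o) by apply: coord_is_scalar.
pose x i : dual V := Dual (introT (asboolP _) (coord_lin i)).
pose c i v := sval (cid (mcoef_rep (x i) v)).
have cE i v f : f (c i v) = coord X i (trlfun (ract M f) v).
  exact: svalP (cid (mcoef_rep (x i) v)) f.
(* [c i v] represents the i-th coordinate of f . v as a function of [f], so slicing [d v] by [f]
   gives back f . v. *)
pose d (v : V) : tensor V C := \sum_(i < \dim {:V}) tens X`_i (c i v).
have d_linear : linear d.
  move=> a u v; rewrite /d scaler_sumr -big_split; apply: eq_bigr => i _ /=.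
  (* The elements [c i v] come from a choice, but they are determined by their values under all
     forms, hence linear in [v]. *)
  rewrite -linearPr; congr (tens _ _); apply/eqP; rewrite -subr_eq0; apply/eqP.
  apply: coreflexive_separated => f.
  rewrite linearB linearP /= !cE.
  by rewrite linearP coord_lin subrr.
pose dL := GRing.isLinear.Build _ _ _ _ d d_linear.
pose D : {linear V -> tensor V C} := HB.pack d dL.
exists D => f; apply/lfunP => v; rewrite lactE /= /d linear_sum /=.
rewrite [RHS](coord_vbasis (memvf _)); apply: eq_bigr => i _.
by rewrite tfold_tens; congr (_ *: _); apply: cE.
Qed.

(** After slicing, the comodule axioms become the module axioms for products and for the unit, which
    is the counit of [C]. *)
Lemma ract_comodule : exists (d : {linear V -> tensor V C}),
  [/\ forall f, lact d f = trlfun (ract M f),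
      forall v, tassoc (tmap d id (d v)) = tmap id comul (d v)
    & forall v, tfold (fun (x : V) (c : C) => counit c *: x) (d v) = v].
Proof.
have [d dE] := ract_lact; exists d; split=> // v.
  apply/eqP; rewrite -subr_eq0; apply/eqP.
  apply: (dual2_separated coreflexive_separated) => f g; rewrite linearB /=.
  rewrite slice_tassoc slice_conv -!lactE -comp_lfunE !dE -trlfun_comp -ractM.
  by rewrite subrr.
apply: etrans (_ : lact d aone v = v); first exact/esym/lactE.
by rewrite dE ract1 trlfun1 id_lfunE.
Qed.

End ModuleToComodule.

(** The comodule has the same underlying space as [M], and transposing twice restores the action; so
    the identity map is an isomorphism. *)
Lemma comod_dual_ess : essentially_surjective (comod_dual C).
Proof.
move=> M; have [d [dE dA d1]] := ract_comodule M.
pose V := FdComod dA d1.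
have mto : mod_mor (V := comod_module V) (W := M) \1%VF.
  by move=> v f; rewrite !id_lfunE /= /tract dE trlfunK ractE.
have mfrom : mod_mor (V := M) (W := comod_module V) \1%VF.
  by move=> v f; rewrite !id_lfunE /= /tract dE trlfunK ractE.
exists V, (@FdHom _ (fdmod_struct (dual C)) (comod_module V) M \1%VF
    (introT (asboolP _) mto)),
  (@FdHom _ (fdmod_struct (dual C)) M (comod_module V) \1%VF
    (introT (asboolP _) mfrom)).
by split; apply: val_inj; rewrite /= comp_lfun1l.
Qed.

End EssentialSurjectivity.

Theorem corollary5p6 (k : fieldType) (C : coalgType k) (hC : coreflexive C) :
  spectra_equivalent (Gc C) (Gk (dual C)).
Proof.
(* [comod_dual] is contravariant, so the comodule category is first replaced by its opposite. *)
apply: rst_trans (ktheory_op _) _.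
apply: (@equivalence_ktheory _ _ (comod_dual C)).
- exact/comod_dual_full/coreflexive_separated.
- exact: comod_dual_faithful.
- exact: comod_dual_ess.
Qed.
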